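(* For every integer $n\ge 3$, \[ H_s(n,2)=\begin{cases}\left\lfloor \frac12\binom n2-\frac32\right\rfloor & \text{if } n\neq 6,\\[2pt] 5=\left\lfloor \frac12\binom 62-\frac32\right\rfloor-1 & \text{if } n=6.\end{cases} \]
   Context: A simplicial complex on $n$ vertices is a family $\mathcal F$ of subsets of $[n]=\{1,\dots,n\}$ closed under taking subsets; it is a simplicial $d$-complex if the maximum size of a set in $\mathcal F$ is $d+1$. The dual graph of a simplicial $d$-complex $\mathcal F$ has as vertices the sets in $\mathcal F$ of size $d+1$, two of them being adjacent if their intersection has size $d$. The diameter of $\mathcal F$ is the diameter of its dual graph. $H_s(n,d)$ denotes the maximum diameter of a simplicial $d$-complex on $n$ vertices whose dual graph is connected. *)

(* Defs.v *)
From mathcomp Require Import all_boot all_order all_algebra.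

Set Implicit Arguments.
Unset Strict Implicit.
Unset Printing Implicit Defensive.

Section Graph.
Variables (T : finType) (e : rel T).

Definition walk (k : nat) (x y : T) : bool :=
  [exists p : k.-tuple T, path e x p && (last x p == y)].

(* The least length of a walk from x to y. Searching lengths below #|T| is
   enough (see [gdistP]); the junk value for disconnected x and y is #|T|. *)
Definition gdist (x y : T) : nat := find (fun k => walk k x y) (iota 0 #|T|).

Definition connected_graph : bool := [forall x, forall y, connect e x y].

Definition diameter : nat := \max_(x : T) \max_(y : T) gdist x y.

Lemma walkP k x y :
  reflect (exists p : seq T, [/\ path e x p, last x p = y & size p = k])
          (walk k x y).
Proof.
apply: (iffP existsP) => [[p /andP[ep /eqP lp]]|[p [ep lp sp]]].
  by exists p; rewrite size_tuple.
by exists (Tuple (introT eqP sp)); rewrite /= ep lp eqxx.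
Qed.

Lemma gdistP x y : connect e x y ->
  walk (gdist x y) x y /\ forall k, walk k x y -> gdist x y <= k.
Proof.
move=> /connectP[p0 ep0 lp0].
have hasw : has (fun k => walk k x y) (iota 0 #|T|).
  case: (shortenP ep0) lp0 => p ep up _ lp.
  apply/hasP; exists (size p); last by apply/walkP; exists p.
  rewrite mem_iota add0n /=.
  by have := max_card (mem (x :: p)); rewrite (card_uniqP up).
have ltd : gdist x y < #|T| by move: hasw; rewrite has_find size_iota.
split; first by have := nth_find 0 hasw; rewrite nth_iota ?add0n.
move=> k wk; rewrite leqNgt; apply/negP => ltk.
have := before_find 0 ltk.
by rewrite nth_iota ?add0n ?wk // (ltn_trans ltk ltd).
Qed.

End Graph.

Section Complex.
Variable n : nat.
Implicit Types (F : {set {set 'I_n}}) (d : nat).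

Definition simplicial_complex F : bool :=
  [forall A in F, forall B : {set 'I_n}, (B \subset A) ==> (B \in F)].

Definition simplicial_dcomplex d F : bool :=
  simplicial_complex F && (\max_(A in F) #|A| == d.+1).

Definition dual_vertex d F : finType :=
  {A : {set 'I_n} | (A \in F) && (#|A| == d.+1)}.

Definition dual_adj d F : rel (dual_vertex d F) :=
  fun A B => #|val A :&: val B| == d.

End Complex.

Definition Hs (n d : nat) : nat :=
  \max_(F : {set {set 'I_n}} |
        simplicial_dcomplex d F && connected_graph (@dual_adj n d F))
     diameter (@dual_adj n d F).

(* Main.v *)
Require Import Defs.
From mathcomp Require Import all_boot all_order all_algebra.
From mathcomp Require Import zify lra.

(**
  A geodesic of the dual graph is a strip of triangles in which only consecutive
  ones share an edge, so [D + 1] triangles use [2 (D + 1) + 1] of the [n choose 2]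
  edges; this gives the upper bound. Conversely every further triangle of a
  strip adds at most two new edges, so a strip of [m] triangles covering
  [2 m + 1] edges is automatically induced, and it suffices to find a strip
  covering all the edges but at most one.

  For [n = 4p+1, 4p+4, 4p+7, 4p+10] with [p >= 3] the vertices are the residues
  modulo an odd [k] and [n - k] points at infinity. The edges between residues
  fall into the classes [{v, v + c}]. A fan at [x] whose spokes [{x, x + u}],
  [L <= u < L + p], are visited in zigzag order covers one edge of each of the
  classes [1, ..., p - 1] and [L, ..., L + p - 1], and consecutive fans are
  linked by an edge of class [p]; a closed chain of translates thus covers all
  these classes. Every other class (at most three) is covered by the fan from a
  point at infinity over the cycle of that class, and the chains of finite fans
  are inserted as detours into the last fan at infinity. The other [n] are
  settled by explicit strips.

  When [n = 6], seven triangles would cover all fifteen edges. A vertex lying in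
  [a] triangles that form [r] runs is on [a + r <= 5] edges, and a run of a
  single triangle occurs only at an end of the strip; hence there are at most
  [6 + 2] runs, whereas seven triangles have nine.
*)

Set Implicit Arguments.
Unset Strict Implicit.
Unset Printing Implicit Defensive.

(** * Induced strips and the dual graph *)

Section Triangles.
Variable T : finType.
Implicit Types (A B t : {set T}) (ts es : seq {set T}).

Definition duos A := [set B : {set T} | (B \subset A) && (#|B| == 2)].

Lemma card_duos A : #|duos A| = 'C(#|A|, 2).
Proof. by rewrite -[RHS](cards_draws A 2). Qed.

Lemma duosI A B : duos (A :&: B) = duos A :&: duos B.
Proof.
by apply/setP=> C; rewrite !inE subsetI; case: (_ == 2); rewrite ?andbT ?andbF.
Qed.

Definition shadow ts := \bigcup_(t <- ts) duos t.

Lemma shadow_cons t ts : shadow (t :: ts) = duos t :|: shadow ts.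
Proof. by rewrite /shadow big_cons. Qed.

Lemma mem_shadow B ts : B \in shadow ts -> exists2 t, t \in ts & B \in duos t.
Proof.
elim: ts => [|t ts IH]; first by rewrite /shadow big_nil inE.
rewrite shadow_cons inE => /orP[Bt|/IH[x xts Bx]]; first by exists t; rewrite ?mem_head.
by exists x => //; rewrite inE xts orbT.
Qed.

Lemma sub_shadow t ts : t \in ts -> duos t \subset shadow ts.
Proof. by move=> tts; rewrite /shadow (big_rem t) //= subsetUl. Qed.

(** A chordless path of the dual graph: triangles that are not consecutive share no edge, so they
    meet in at most one vertex. *)
Fixpoint induced_strip ts : bool :=
  if ts is t :: r then
    [&& #|t| == 3,
        (if r is x :: r' then (#|t :&: x| == 2) && all (fun y => #|t :&: y| <= 1) r'
         else true)
      & induced_strip r]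
  else true.

Lemma duos_small A : #|A| <= 1 -> duos A = set0.
Proof. by move=> cA; apply/eqP; rewrite -cards_eq0 card_duos bin_small. Qed.

(** The only edge of the first triangle that occurs again is the one shared with the second, so each
    triangle put in front adds exactly two edges. *)
Lemma card_shadow ts : ts != [::] -> induced_strip ts -> #|shadow ts| = (size ts).*2.+1.
Proof.
elim: ts => // t [|x r] IH _.
  by rewrite /= andbT => /eqP t3; rewrite /shadow big_seq1 card_duos t3.
move=> /and3P[/eqP t3 /andP[/eqP tx tr] str].
rewrite shadow_cons cardsU card_duos t3 (IH isT str).
have -> : duos t :&: shadow (x :: r) = duos (t :&: x).
  apply/setP=> B; rewrite shadow_cons duosI !in_setI in_setU.
  case Bt : (B \in duos t) => //=; case: (B \in duos x) => //=.
  apply/negP=> /mem_shadow[y yr By]; have /duos_small d0 := allP tr y yr.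
  by have := in_set0 B; rewrite -d0 duosI in_setI Bt By.
by rewrite card_duos tx binn [X in X + _](_ : _ = 3) //=; lia.
Qed.

Lemma induced_stripP ts :
  (forall i, i < size ts -> #|nth set0 ts i| = 3) ->
  (forall i, i.+1 < size ts -> #|nth set0 ts i :&: nth set0 ts i.+1| = 2) ->
  (forall i j, i.+1 < j < size ts -> #|nth set0 ts i :&: nth set0 ts j| <= 1) ->
  induced_strip ts.
Proof.
elim: ts => // t r IH H3 H2 H1 /=; rewrite (H3 0) //= IH ?andbT.
- case: r {IH} H3 H2 H1 => //= x r H3 H2 H1; rewrite (H2 0) //=.
  by apply/(all_nthP set0)=> i ir; apply: (H1 0 i.+2).
- by move=> i ir; apply: (H3 i.+1).
- by move=> i ir; apply: (H2 i.+1).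
by move=> i j ij; apply: (H1 i.+1 j.+1).
Qed.

Lemma induced_far ts i j : induced_strip ts -> i < j < size ts ->
  1 < #|nth set0 ts i :&: nth set0 ts j| -> j = i.+1.
Proof.
elim: ts i j => [|t r IH] [|i] [|j] //=; first by lia.
  case: r IH => //= x r _ /and3P[_ /andP[_ tr] _]; case: j => //= j jr.
  by rewrite ltnNge (allP tr) // mem_nth.
by move=> /and3P[_ _ /IH{}IH] ij c; rewrite (IH i j).
Qed.

Lemma induced_card ts t : induced_strip ts -> t \in ts -> #|t| = 3.
Proof.
elim: ts => //= x r IH /and3P[/eqP x3 _ /IH{}IH].
by rewrite inE => /predU1P[->|/IH].
Qed.

Lemma induced_adj ts i : induced_strip ts -> i.+1 < size ts ->
  #|nth set0 ts i :&: nth set0 ts i.+1| = 2.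
Proof.
elim: ts i => [|t r IH] [|i] //=.
  by case: r {IH} => //= x r /and3P[_ /andP[/eqP]].
by move=> /and3P[_ _ /IH{}IH]; apply: IH.
Qed.

(* A strip is recorded by its consecutive shared edges: its triangles are the
   unions of two consecutive edges. *)
Definition meets (e f : {set T}) := [&& #|e| == 2, #|f| == 2 & #|e :&: f| == 1].

Fixpoint triangles es : seq {set T} :=
  if es is e :: r then
    if r is f :: _ then (e :|: f) :: triangles r else [::]
  else [::].

Lemma size_triangles es : size (triangles es) = (size es).-1.
Proof. by elim: es => //= e [|f r] //= ->. Qed.

Lemma card_shadow_meets es : 1 < size es -> sorted meets es ->
  #|shadow (triangles es)| <= (size es).*2.-1.
Proof.
elim: es => // e [|f r] IH // _ /= /andP[ef].
have [/eqP e2 f2 /eqP ef1] := and3P ef.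
have c3 : #|e :|: f| = 3 by rewrite cardsU e2 (eqP f2) ef1.
case: r IH => [|g r] IH.
  by move=> _; rewrite /shadow big_seq1 card_duos c3.
move/(IH isT) => {}IH; rewrite shadow_cons cardsU card_duos c3.
suff: 0 < #|duos (e :|: f) :&: shadow (triangles [:: f, g & r])|.
  by move: IH; rewrite /= [in X in X -> _]/= (_ : 'C(3, 2) = 3) //; lia.
apply/card_gt0P; exists f; rewrite in_setI shadow_cons in_setU !inE.
by rewrite subsetUr subsetUl f2 /=.
Qed.

(* Every triangle after the first adds at most two new edges, so a strip with
   as many edges as possible cannot revisit an edge. *)
Lemma tight_strip es : 1 < size es -> sorted meets es ->
  (size es).*2.-1 <= #|shadow (triangles es)| -> induced_strip (triangles es).
Proof.
elim: es => // e [|f r] IH // _ /= /andP[ef].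
have [/eqP e2 /eqP f2 /eqP ef1] := and3P ef.
have c3 : #|e :|: f| = 3 by rewrite cardsU e2 f2 ef1.
case: r IH => [|g r] IH; first by rewrite /= c3.
move=> sr; have /andP[fg _] : meets f g && path meets g r by [].
have [_ /eqP g2 /eqP fg1] := and3P fg.
have c3' : #|f :|: g| = 3 by rewrite cardsU f2 g2 fg1.
set ts := triangles [:: f, g & r] in IH *; set t := e :|: f.
have tsE : ts = (f :|: g) :: triangles (g :: r) by [].
rewrite shadow_cons cardsU card_duos c3 (_ : 'C(3, 2) = 3) // => big.
have le := @card_shadow_meets [:: f, g & r] isT sr.
have fI : f \in duos t :&: shadow ts.
  by rewrite tsE in_setI shadow_cons in_setU !inE subsetUr subsetUl f2 eqxx.
have ps : 0 < #|duos t :&: shadow ts| by apply/card_gt0P; exists f.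
have {}IH : induced_strip ts.
  apply: IH => //; move: big ps; rewrite -/ts.
  by move: #|shadow ts| #|_ :&: _| => N I /=; lia.
(* Equality in the count leaves [f] as the only edge of [t] that the rest of the strip covers. *)
have I1 : duos t :&: shadow ts = [set f].
  apply/esym/eqP; rewrite eqEcard sub1set fI cards1 /=.
  by move: big le; rewrite -/ts; move: #|shadow ts| #|_ :&: _| => N I /=; lia.
have far x : x \in ts -> #|t :&: x| <= 2 /\ (1 < #|t :&: x| -> f \subset x).
  move=> xts.
  have sub : duos (t :&: x) \subset [set f].
    by rewrite -I1 duosI setIS // sub_shadow.
  split.
    rewrite leqNgt; apply/negP=> c; have := subset_leq_card sub.
    by rewrite cards1 card_duos; apply/negP; rewrite -ltnNge (leq_trans _ (leq_bin2l 2 c)).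
  move=> c; have : 0 < #|duos (t :&: x)| by rewrite card_duos bin_gt0.
  case/card_gt0P=> B Bx; have /set1P Bf := subsetP sub B Bx.
  by move: Bx; rewrite Bf duosI in_setI !inE => /and3P[_ ].
suff H : (#|t :&: (f :|: g)| == 2) &&
    all (fun y => #|t :&: y| <= 1) (triangles (g :: r)).
  by rewrite -/ts -/t /=; apply/andP; split; [exact: H|exact: IH].
have [le2 _] := far (f :|: g) (mem_head _ _).
apply/andP; split.
  rewrite eqn_leq le2 -f2 subset_leq_card // subsetI subsetUr subsetUl //.
apply/allP=> x xr; rewrite leqNgt; apply/negP=> c.
have xts : x \in ts by rewrite tsE inE xr orbT.
have fx : f \subset x by case: (far x xts) => _; apply.
case: r @ts sr le {c} tsE fI ps IH I1 far xts big xr le2 => // h r ts sr _ tsE _ _ IH _ _ _ _ + _.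
(* A later triangle through [f] contradicts the induced tail: [g :|: h] would contain [f :|: g], and
   the others meet [f :|: g] in at most one vertex. *)
have /= /and3P[_ /andP[/eqP fgh fgs] _] : induced_strip ts by [].
rewrite inE => /predU1P[xE|/(allP fgs)].
  move: fgh; rewrite (setIidPl _) ?c3' // subUset subsetUl andbT -xE //.
move=> le1; have : #|f| <= #|(f :|: g) :&: x| by rewrite subset_leq_card // subsetI subsetUl.
by rewrite f2 leqNgt ltnS le1.
Qed.
End Triangles.

(** * Geodesics of the dual graph as induced strips *)

Section Dual.
Variable n : nat.

Section Walks.
Variables (V : finType) (e : rel V).

Lemma walk_cat a b x y z : walk e a x y -> walk e b y z -> walk e (a + b) x z.
Proof.
move=> /walkP[p [ep lp sp]] /walkP[q [eq lq sq]]; apply/walkP; exists (p ++ q).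
by rewrite cat_path ep last_cat lp eq lq size_cat sp sq.
Qed.

Lemma walk_split x p i : path e x p -> i <= size p ->
  walk e i x (nth x (x :: p) i) /\ walk e (size p - i) (nth x (x :: p) i) (last x p).
Proof.
move=> ep ip; have lt : last x (take i p) = nth x (x :: p) i.
  by rewrite (last_nth x) size_takel // -[x :: take i p]/(take i.+1 (x :: p)) nth_take.
move: ep; rewrite -{1}(cat_take_drop i p) cat_path => /andP[e1 e2].
split; apply/walkP; first by exists (take i p); rewrite size_takel.
exists (drop i p); rewrite size_drop -lt e2; split => //.
by rewrite -[in RHS](cat_take_drop i p) last_cat.
Qed.
End Walks.

Variable F : {set {set 'I_n}}.
Let V := dual_vertex 2 F.
Let adj : rel V := @dual_adj n 2 F.

Lemma dual_vertex_card (A : V) : #|val A| = 3.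
Proof. by case: A => A /= /andP[_ /eqP]. Qed.

(** If two triangles that are not consecutive on a shortest walk were equal or adjacent, a shortcut
    of length 0 or 1 would exist. *)
Lemma geodesic_strip (x y : V) : connect adj x y ->
  exists2 ts : seq {set 'I_n}, size ts = (gdist adj x y).+1 & induced_strip ts.
Proof.
move=> /gdistP[/walkP[p [ep lp sp]] min].
pose v i := nth x (x :: p) i.
have tv i : i < (size p).+1 -> nth set0 (map val (x :: p)) i = val (v i).
  by move=> ip; rewrite (nth_map x).
exists (map val (x :: p)); first by rewrite size_map /= sp.
have ssz : size (map val (x :: p)) = (size p).+1 by rewrite size_map.
apply: induced_stripP; rewrite ssz.
- by move=> i ip; rewrite tv // dual_vertex_card.
- move=> i ip; rewrite !tv //; last by lia.
  by move/(pathP x)/(_ i): ep => /(_ ip)/eqP.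
move=> i j ij; rewrite !tv; try lia.
rewrite leqNgt; apply/negP=> c2.
have w : exists2 b, b <= 1 & walk adj b (v i) (v j).
  have [vij|vij] := eqVneq (v i) (v j).
    by exists 0 => //; apply/walkP; exists [::]; rewrite vij.
  exists 1 => //; apply/walkP; exists [:: v j]; rewrite /= andbT.
  split => //; rewrite /adj /dual_adj eqn_leq c2 andbT leqNgt; apply/negP=> c3.
  case/eqP: vij; apply: val_inj.
  have /eqP Ei : val (v i) :&: val (v j) == val (v i).
    by rewrite eqEcard subsetIl dual_vertex_card.
  have /eqP Ej : val (v i) :&: val (v j) == val (v j).
    by rewrite eqEcard subsetIr dual_vertex_card.
  exact: etrans (esym Ei) Ej.
case: w => b b1 wb.
have ip : i <= size p by lia.
have jp : j <= size p by lia.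
have [wi _] := walk_split ep ip; have [_ wj] := walk_split ep jp.
have := walk_cat (walk_cat wi wb) wj; rewrite lp => /min; rewrite -sp; lia.
Qed.
End Dual.

Lemma Hs_le n D :
  (forall ts : seq {set 'I_n}, induced_strip ts -> size ts <= D.+1) -> Hs n 2 <= D.
Proof.
move=> H; apply/bigmax_leqP=> F /andP[_ /forallP conn].
apply/bigmax_leqP=> x _; apply/bigmax_leqP=> y _.
have [ts st] := geodesic_strip (forallP (conn x) y).
by move/H; rewrite st.
Qed.

Lemma size_induced_strip n (ts : seq {set 'I_n}) :
  induced_strip ts -> ts != [::] -> (size ts).*2.+1 <= 'C(n, 2).
Proof.
move=> its tn; rewrite -(card_shadow tn its).
rewrite -[in X in _ <= X](card_ord n) -card_draws; apply: subset_leq_card.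
by apply/subsetP=> B /mem_shadow[t _]; rewrite !inE => /andP[].
Qed.

Lemma induced_uniq (T : finType) (ts : seq {set T}) : induced_strip ts -> uniq ts.
Proof.
move=> its; apply/(uniqP set0)=> i j; rewrite !inE => ip jp.
wlog ij : i j ip jp / i < j.
  by move=> H E; case: (ltngtP i j) => [ij|ji|//]; [apply: H|apply/esym/H].
move=> E; have := @induced_far _ ts i j its; rewrite ij jp E setIid.
rewrite (induced_card its) ?mem_nth // => /(_ isT isT) ji.
have := @induced_adj _ ts i its; rewrite -ji jp E setIid.
by rewrite (induced_card its) ?mem_nth // => /(_ isT).
Qed.

(** * The complex spanned by an induced strip *)

Section StripComplex.
Variables (n : nat) (ts : seq {set 'I_n}).
Hypotheses (its : induced_strip ts) (ts0 : ts != [::]).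

Definition strip_complex := [set A : {set 'I_n} | has (fun t : {set 'I_n} => A \subset t) ts].

Lemma strip_complex_dim : simplicial_dcomplex 2 strip_complex.
Proof.
apply/andP; split.
  apply/forall_inP=> A; rewrite inE => /hasP[t tts At].
  apply/forallP=> B; apply/implyP=> BA; rewrite inE; apply/hasP.
  by exists t => //; apply: subset_trans At.
rewrite eqn_leq; apply/andP; split.
  apply/bigmax_leqP=> A; rewrite inE => /hasP[t tts /subset_leq_card].
  by rewrite (induced_card its tts).
have t0 : nth set0 ts 0 \in ts by rewrite mem_nth //; case: ts ts0.
rewrite -(induced_card its t0).
apply: (@leq_bigmax_cond _ (mem strip_complex) (fun A : {set 'I_n} => #|A|) (nth set0 ts 0)).
by rewrite /= inE; apply/hasP; exists (nth set0 ts 0).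
Qed.

Let V := dual_vertex 2 strip_complex.
Let adj : rel V := @dual_adj n 2 strip_complex.

Lemma strip_vertexP (A : {set 'I_n}) :
  ((A \in strip_complex) && (#|A| == 3)) = (A \in ts).
Proof.
apply/idP/idP=> [/andP[]|Ats].
  rewrite inE => /hasP[t tts At] /eqP A3.
  have /eqP-> : A == t by rewrite eqEcard At A3 (induced_card its tts).
  by [].
rewrite (induced_card its Ats) eqxx andbT inE; apply/hasP.
by exists A.
Qed.

Lemma strip_vertex_mem (A : V) : val A \in ts.
Proof. by rewrite -strip_vertexP; case: A. Qed.

Lemma strip_vertex A : A \in ts -> exists v : V, val v = A.
Proof.
rewrite -strip_vertexP => Av.
by exists (exist (fun A => (A \in strip_complex) && (#|A| == 2.+1)) A Av).
Qed.

Lemma strip_adj_index (A B : V) :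
  adj A B -> index (val B) ts <= (index (val A) ts).+1.
Proof.
have [As Bs] := (strip_vertex_mem A, strip_vertex_mem B).
rewrite /adj /dual_adj => /eqP AB; rewrite leqNgt; apply/negP=> lt.
have := @induced_far _ ts (index (val A) ts) (index (val B) ts) its.
rewrite index_mem Bs !nth_index // AB => H.
have ltAB : index (val A) ts < index (val B) ts by lia.
by move: lt; rewrite H ?ltAB // ltnn.
Qed.

Lemma strip_walk k (A B : V) :
  walk adj k A B -> index (val B) ts <= index (val A) ts + k.
Proof.
move=> /walkP[p [ep <- <-]]; elim: p A ep => [|C p IH] A /=; first by rewrite addn0.
move=> /andP[/strip_adj_index AC /IH H].
by apply: leq_trans H _; rewrite addnS -addSn leq_add2r.
Qed.

Lemma strip_connected : connected_graph adj.
Proof.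
have sym : symmetric adj by move=> A B; rewrite /adj /dual_adj setIC.
have V0 : nth set0 ts 0 \in ts by rewrite mem_nth //; case: ts ts0.
have [v0 v0E] := strip_vertex V0.
have c0 (A : V) : connect adj v0 A.
  have := strip_vertex_mem A; move: {2}(index _ _) (erefl (index (val A) ts)) => i.
  elim: i A => [|i IH] A iA As.
    suff -> : A = v0 by apply: connect0.
    by apply: val_inj; rewrite v0E -[LHS](nth_index set0 As) iA.
  have lt : i.+1 < size ts by rewrite -iA index_mem.
  have Bs : nth set0 ts i \in ts by rewrite mem_nth // ltnW.
  have [B BE] := strip_vertex Bs.
  have BA : adj B A.
    rewrite /adj /dual_adj BE -[val A](nth_index set0 As) iA.
    by rewrite (induced_adj its lt).
  apply: connect_trans (connect1 BA); apply: IH; rewrite BE //.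
  by rewrite index_uniq ?induced_uniq // ltnW.
apply/forallP=> A; apply/forallP=> B; apply: connect_trans (c0 B).
by rewrite (sym_connect_sym sym) c0.
Qed.

(** A step in the dual graph raises the position in the strip by at most one, so the first and the
    last triangle are at distance at least [(size ts).-1]. *)
Lemma Hs_ge_strip : (size ts).-1 <= Hs n 2.
Proof.
pose D := diameter adj.
apply: (@leq_trans D); last first.
  by apply: (@leq_bigmax_cond _ _ (fun F => diameter (@dual_adj n 2 F)) strip_complex);
     rewrite strip_complex_dim strip_connected.
have lt0 : 0 < size ts by case: ts ts0.
have V0 : nth set0 ts 0 \in ts by rewrite mem_nth.
have V1 : nth set0 ts (size ts).-1 \in ts by rewrite mem_nth // prednK.
have [v0 v0E] := strip_vertex V0; have [v1 v1E] := strip_vertex V1.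
apply: (@leq_trans (gdist adj v0 v1)); last first.
  apply: leq_trans (leq_bigmax v0); exact: (leq_bigmax v1).
have [/strip_walk + _] := gdistP (forallP (forallP strip_connected v0) v1).
by rewrite v0E v1E !index_uniq ?prednK // ?induced_uniq // add0n.
Qed.
End StripComplex.

(** * Strips as sequences of edges *)

Implicit Types (e f : nat * nat) (es : seq (nat * nat)).

(** The counterpart of [meets] for unordered pairs of numbers, suited to computation: the exclusive
    or asks that exactly one end of [e] lie on [f]. *)
Definition touch e f : bool :=
  [&& e.1 != e.2, f.1 != f.2 &
      ((e.1 == f.1) || (e.1 == f.2)) (+) ((e.2 == f.1) || (e.2 == f.2))].

Definition joint e f (x : nat) : bool := x \in [:: e.1; e.2; f.1; f.2].

Definition consec (T : Type) (s : seq T) x y := exists s1 s2, s = s1 ++ x :: y :: s2.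

(** Some triangle of the strip contains all of [vs]; with two vertices this says that an edge is
    covered. *)
Definition covered es (vs : seq nat) := exists e f, consec es e f /\ all (joint e f) vs.

Lemma consec_catl (T : Type) (s1 s : seq T) x y : consec s x y -> consec (s1 ++ s) x y.
Proof. by move=> [a [b ->]]; exists (s1 ++ a), b; rewrite -!catA. Qed.

Lemma consec_catr (T : Type) (s2 s : seq T) x y : consec s x y -> consec (s ++ s2) x y.
Proof. by move=> [a [b ->]]; exists a, (b ++ s2); rewrite -!catA. Qed.

Lemma consec_head (T : Type) (x y : T) s : consec (x :: y :: s) x y.
Proof. by exists [::], s. Qed.

Lemma consec_cat_last (T : Type) (x : T) s1 s2 a b :
  consec (last x s1 :: s2) a b -> consec (x :: s1 ++ s2) a b.
Proof.
by elim: s1 x => //= y s1 IH x /IH; apply: (@consec_catl _ [:: x]).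
Qed.

Lemma covered_catl s1 es vs : covered es vs -> covered (s1 ++ es) vs.
Proof. by move=> [e [f [c H]]]; exists e, f; split=> //; apply: consec_catl. Qed.

Lemma covered_catr s2 es vs : covered es vs -> covered (es ++ s2) vs.
Proof. by move=> [e [f [c H]]]; exists e, f; split=> //; apply: consec_catr. Qed.

Lemma covered_cons e es vs : covered es vs -> covered (e :: es) vs.
Proof. exact: (@covered_catl [:: e]). Qed.

Lemma covered_cat_head e s1 s2 vs : covered (e :: s1) vs -> covered (e :: s1 ++ s2) vs.
Proof. exact: (@covered_catr s2 (e :: s1)). Qed.

(** Keeps the triangle at the junction of the two pieces, which [covered_catl] would lose. *)
Lemma covered_cat_last e s1 s2 vs : covered (last e s1 :: s2) vs -> covered (e :: s1 ++ s2) vs.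
Proof. by move=> [a [b [c H]]]; exists a, b; split=> //; apply: consec_cat_last. Qed.

Lemma covered_sub es vs ws : {subset ws <= vs} -> covered es vs -> covered es ws.
Proof.
move=> sub [e [f [c H]]]; exists e, f; split=> //.
by apply/allP=> w /sub; apply: (allP H).
Qed.

Lemma coveredC es x y : covered es [:: x; y] -> covered es [:: y; x].
Proof. by apply: covered_sub=> v; rewrite !inE orbC. Qed.

Lemma covered_head e f es vs : all (joint e f) vs -> covered [:: e, f & es] vs.
Proof. by exists e, f; split=> //; apply: consec_head. Qed.

Lemma consec_nth (T : Type) (x0 : T) s i : i.+1 < size s -> consec s (nth x0 s i) (nth x0 s i.+1).
Proof.
move=> lt; exists (take i s), (drop i.+2 s).
by rewrite -!drop_nth ?cat_take_drop // ltnW.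
Qed.

Lemma covered_mem es e : 1 < size es -> e \in es -> covered es [:: e.1; e.2].
Proof.
move=> s2 /(nthP (0, 0))[i lt <-].
have [lt'|ge] := ltnP i.+1 (size es).
  exists (nth (0, 0) es i), (nth (0, 0) es i.+1); split; first exact: consec_nth.
  by rewrite /= /joint !inE !eqxx ?orbT.
case: i lt ge => [|i] lt ge; first by lia.
exists (nth (0, 0) es i), (nth (0, 0) es i.+1); split; first exact: consec_nth.
by rewrite /= /joint !inE !eqxx ?orbT.
Qed.

Lemma touchP a b c : a != b -> a != c -> b != c ->
  [/\ touch (a, b) (a, c), touch (a, b) (c, a), touch (b, a) (a, c) & touch (b, a) (c, a)].
Proof.
rewrite /touch /= => ab ac bc; rewrite !eqxx !(eq_sym b a) !(eq_sym c a) (negPf ab) (negPf ac).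
by rewrite !(negPf bc) ?orbT.
Qed.

(** * From pairs of numbers to subsets of the vertex set *)

Section ToOrd.
Variable n : nat.

Definition eset e : {set 'I_n} := [set i : 'I_n | (val i == e.1) || (val i == e.2)].

Lemma esetE (a b : 'I_n) : eset (val a, val b) = [set a; b].
Proof. by apply/setP=> i; rewrite !inE /= !val_eqE. Qed.

Lemma touch_meets e f : (e.1 < n) && (e.2 < n) -> (f.1 < n) && (f.2 < n) ->
  touch e f -> meets (eset e) (eset f).
Proof.
case: e f => [a b] [c d] /= /andP[an bn] /andP[cn dn].
rewrite -[a]/(val (Ordinal an)) -[b]/(val (Ordinal bn)).
rewrite -[c]/(val (Ordinal cn)) -[d]/(val (Ordinal dn)).
move: (Ordinal an) (Ordinal bn) (Ordinal cn) (Ordinal dn) => {an bn cn dn} {}a {}b {}c {}d.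
rewrite /touch /= !val_eqE /meets !esetE !cards2 => /and3P[-> -> x] /=.
have -> : [set a; b] :&: [set c; d] = [set i in [:: a; b] | (i == c) || (i == d)].
  by apply/setP=> i; rewrite !inE.
move: x; case A : ((a == c) || (a == d)); case B : ((b == c) || (b == d)) => // _.
  suff -> : [set i in [:: a; b] | (i == c) || (i == d)] = [set a] by rewrite cards1.
  apply/setP=> i; rewrite !inE; case: (eqVneq i a) => [->|] //=; case: (eqVneq i b) => [->|] //=.
suff -> : [set i in [:: a; b] | (i == c) || (i == d)] = [set b] by rewrite cards1.
apply/setP=> i; rewrite !inE; case: (eqVneq i b) => [->|] //=; first by rewrite orbT.
by case: (eqVneq i a) => [->|] //=; rewrite A.
Qed.

Lemma mem_triangles (es s1 s2 : seq {set 'I_n}) (e f : {set 'I_n}) :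
  es = s1 ++ e :: f :: s2 -> e :|: f \in triangles es.
Proof.
move=> ->; elim: s1 => [|a s1 IH] /=; first by rewrite mem_head.
by case: s1 IH => [|b s1] /= IH; rewrite inE IH orbT.
Qed.

(** [X] lists the pairs that may stay uncovered. The shadow then has at least [(size es).*2.-1]
    edges, so [tight_strip] makes the strip induced, and its [(size es).-1] triangles yield the
    diameter. *)
Lemma strip_Hs es (X : seq (nat * nat)) :
  sorted touch es -> all (fun e => (e.1 < n) && (e.2 < n)) es -> 1 < size es ->
  (forall x y, x < y -> y < n -> covered es [:: x; y] \/ (x, y) \in X) ->
  (size es).*2 + size X <= 'C(n, 2).+1 -> (size es).-2 <= Hs n 2.
Proof.
move=> tes bes s2 cov big; set S := map eset es.
have sS : size S = size es by rewrite size_map.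
have mS : sorted (@meets _) S.
  case: es tes bes {s2 cov big sS} @S => //= e es.
  elim: es e => //= f es IH e /andP[ef pes] /and3P[be bf bes].
  by rewrite touch_meets //= IH // bf.
have ts0 : triangles S != [::] by rewrite -size_eq0 size_triangles sS; case: (es) s2 => [|? []].
suff its : induced_strip (triangles S).
  by have := Hs_ge_strip its ts0; rewrite size_triangles sS.
apply: tight_strip; rewrite ?sS //.
pose XS := [set B in [seq eset e | e <- X]].
have cX : #|XS| <= size X by rewrite -(size_map eset) cardsE card_size.
have sub : [set B : {set 'I_n} | #|B| == 2] \subset shadow (triangles S) :|: XS.
  apply/subsetP=> B; rewrite inE => /cards2P[a [b [ab ->]]].
  wlog lt : a b ab / val a < val b.
    move=> H; case: (ltngtP (val a) (val b)) => [|ba|/val_inj E]; first exact: H.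
      by rewrite setUC; apply: H => //; rewrite eq_sym.
    by rewrite E eqxx in ab.
  rewrite in_setU; have := cov _ _ lt (ltn_ord b).
  move=> [[e [f [[u [v E]] /= /and3P[ja jb _]]]]|inX]; last first.
    by rewrite !inE; apply/orP; right; apply/mapP; exists (val a, val b) => //; rewrite esetE.
  apply/orP; left.
  have : eset e :|: eset f \in triangles S.
    by apply: (@mem_triangles S (map eset u) (map eset v)); rewrite /S E map_cat.
  move/sub_shadow/subsetP; apply; rewrite inE cards2 ab andbT subUset !sub1set !inE.
  by move: ja jb; rewrite /joint !inE -!orbA => -> ->.
have := leq_trans (subset_leq_card sub) (leq_card_setU _ _).
rewrite card_draws card_ord => le; have {le cX}le := leq_trans le (leq_add (leqnn _) cX).
by move: le big; move: 'C(n, 2) #|_| => C N; lia.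
Qed.
End ToOrd.

(** * Cyclic strips *)

Definition fan (I : nat) (vs : seq nat) := [seq (I, v) | v <- vs].

Lemma path_fan I v vs : I != v -> all (fun w => I != w) vs ->
  path (fun a b => a != b) v vs -> path touch (I, v) (fan I vs).
Proof.
elim: vs v => //= w vs IH v Iv /andP[Iw Ivs] /andP[vw pvs].
by rewrite IH // andbT; case: (touchP Iv Iw vw).
Qed.

Lemma fan_consec I vs a b : consec vs a b -> covered (fan I vs) [:: I; a; b].
Proof.
move=> [s1 [s2 ->]]; exists (I, a), (I, b); split.
  by exists (fan I s1), (fan I s2); rewrite /fan map_cat.
by rewrite /= /joint /= !inE !eqxx ?orbT.
Qed.

Lemma fan_mem I vs v : 1 < size vs -> v \in vs -> covered (fan I vs) [:: I; v].
Proof. by move=> s2 vv; apply: (@covered_mem _ (I, v)); rewrite ?size_map // map_f. Qed.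

Section Cyclic.
Variable k : nat.
Hypothesis k0 : 0 < k.

Definition medge a b : nat * nat := (a %% k, b %% k).

Definition below e := (e.1 < k) && (e.2 < k).

Lemma below_medge a b : below (medge a b).
Proof. by rewrite /below !ltn_mod k0. Qed.

Lemma neq_mod a b : (a < b < a + k) || (b < a < b + k) -> a %% k != b %% k.
Proof.
wlog ab : a b / a < b.
  move=> H h; have [ab|ba] : a < b \/ b < a by lia.
    exact: H.
  by rewrite eq_sym; apply: H; rewrite // orbC.
move=> h; apply/negP=> E.
have /dvdnP[d dE] : k %| b - a by rewrite -eqn_mod_dvd ?(ltnW ab) // eq_sym.
by case: d dE => [|d] dE; nia.
Qed.

Lemma eq_mod_addM a b d : a = b + d * k -> a %% k = b %% k.
Proof. by move=> ->; rewrite addnC modnMDl. Qed.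

Lemma eq_modDr a b c : a = b %[mod k] -> a + c = b + c %[mod k].
Proof. by move=> E; rewrite -modnDml E modnDml. Qed.

(** [a * k.-1] stands for -a modulo [k], which avoids truncated subtraction. *)
Lemma eq_mod_shift v a : v + a * k.-1 + a = v %[mod k].
Proof.
apply: (@eq_mod_addM _ _ a); have -> : a * k = a + a * k.-1 by rewrite -mulnS prednK.
by rewrite -addnA [_ + a]addnC.
Qed.

(** One of the differences y - x and x - y modulo the odd [k] is at most [k./2]; the disjunction
    records which. *)
Lemma pair_class x y : odd k -> x < y < k -> exists v c, [/\ 0 < c <= k./2, v < k &
  (x = v %% k /\ y = (v + c) %% k) \/ (y = v %% k /\ x = (v + c) %% k)].
Proof.
move=> ok xy; have ko := odd_double_half k; rewrite ok in ko.
have [le|gt] := leqP (y - x) k./2.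
  exists x, (y - x); split; [by lia|by lia|left].
  have -> : x + (y - x) = y by lia.
  by rewrite !modn_small; lia.
exists y, (k - (y - x)); split; [by lia|by lia|right].
rewrite modn_small; last by lia.
split=> //; rewrite (@eq_mod_addM _ x 1); last by lia.
by rewrite modn_small; lia.
Qed.

Lemma eq_mod_cancelr a b c : a + c = b + c %[mod k] -> a = b %[mod k].
Proof. by move/eqP; rewrite eqn_modDr => /eqP. Qed.

(** * Zigzag fans of residues *)

Variables p L : nat.
Hypotheses (p3 : 2 < p) (L0 : 0 < L) (Lk : L + p < k).
Let s := p.-1.

(* The zigzag order [L, L+s, L+1, L+s-1, ...] of the spokes of one fan: the
   differences of successive values are [s, s-1, ..., 1]. *)
Definition zigzag i := if odd i then L + s - i./2 else L + i./2.
Definition mid := L + s./2.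
Definition pitch := p./2.

Lemma mid_pitch : mid + pitch = L + s.
Proof. by rewrite /mid /pitch /s; lia. Qed.

Lemma mid_bounds : L <= mid < L + p.
Proof. by rewrite /mid /s; lia. Qed.

Lemma zigzag_bounds i : i <= s -> L <= zigzag i <= L + s.
Proof. by rewrite /zigzag; case: ifP => ? ?; lia. Qed.

Lemma zigzag_surj u : L <= u <= L + s -> exists2 i, i <= s & zigzag i = u.
Proof.
move=> h; have [le|gt] := leqP (u - L).*2 s.
  by exists (u - L).*2; rewrite // /zigzag odd_double doubleK; lia.
exists (s - (u - L)).*2.+1; first by lia.
by rewrite /zigzag /= odd_double /= uphalf_double; lia.
Qed.

Lemma zigzag_top :
  (zigzag s.-1 = mid /\ zigzag s = mid.+1) \/ (zigzag s.-1 = mid.+1 /\ zigzag s = mid).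
Proof.
rewrite /zigzag /mid; have : s = (s.-1).+1 by rewrite /s; lia.
case E : (odd s.-1) => e; [right|left]; rewrite e /= E /=.
  by split=> //; rewrite ?uphalf_half E /=; lia.
by split=> //; rewrite ?uphalf_half E /=; lia.
Qed.

Lemma zigzag_rim c : 0 < c <= s -> exists2 i, i < s &
  exists a, (zigzag i = a /\ zigzag i.+1 = a + c) \/ (zigzag i = a + c /\ zigzag i.+1 = a).
Proof.
move=> cs; exists (s - c); first by lia.
rewrite /zigzag /=; case: ifP => o /=.
  exists (L + uphalf (s - c)); right; rewrite /uphalf -/(uphalf _) uphalf_half o; lia.
exists (L + (s - c)./2); left; rewrite uphalf_half o; lia.
Qed.

(** The strip enters the fan at [x] through [inner x], the rim edge joining the last two zigzag
    values. It leaves through [closeO x], the longest rim edge, or through [closeL x], the spoke to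
    [zigzag 0]. *)
Definition inner x := medge (x + mid) (x + mid.+1).
Definition closeO x := medge (x + L) (x + L + s).
Definition closeL x := medge x (x + L).

(** The list stops at [zigzag 1], and a fan starts it at [zigzag s.-1]: the edge [inner x] already
    brings in [zigzag s], and the closing edge brings in [zigzag 0]. *)
Fixpoint spokes x i := if i is j.+1 then medge x (x + zigzag j.+1) :: spokes x j else [::].

Lemma size_spokes x i : size (spokes x i) = i.
Proof. by elim: i => //= i ->. Qed.

Lemma last_spokes x i : 0 < i ->
  last (medge x (x + zigzag i)) (spokes x i.-1) = medge x (x + zigzag 1).
Proof. by elim: i => // [[|i]] //= IH _; rewrite IH. Qed.

Definition centre es x := forall i, i < s ->
  covered es [:: x %% k; (x + zigzag i) %% k; (x + zigzag i.+1) %% k].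

Definition link es x := covered es [:: (x + L) %% k; (x + L + p) %% k].

Lemma touch_medge a b c : a %% k != b %% k -> a %% k != c %% k -> b %% k != c %% k ->
  [/\ touch (medge a b) (medge a c), touch (medge a b) (medge c a),
      touch (medge b a) (medge a c) & touch (medge b a) (medge c a)].
Proof. exact: touchP. Qed.

Lemma zigzag_inj i j : i <= s -> j <= s -> zigzag i = zigzag j -> i = j.
Proof.
move=> hi hj; rewrite /zigzag; have ei := odd_double_half i; have ej := odd_double_half j.
by case: (odd i) ei; case: (odd j) ej => /= ej ei; lia.
Qed.

Lemma spokes_touch x i j : i <= s -> j <= s -> i != j ->
  touch (medge x (x + zigzag i)) (medge x (x + zigzag j)).
Proof.
move=> hi hj ij; have := zigzag_bounds hi; have := zigzag_bounds hj.
have : zigzag i <> zigzag j by move=> /(zigzag_inj hi hj) E; rewrite E eqxx in ij.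
rewrite /s => n b1 b2; apply touch_medge; apply: neq_mod; lia.
Qed.

Lemma path_spokes x i : 0 < i <= s -> path touch (medge x (x + zigzag i)) (spokes x i.-1).
Proof.
elim: i => [|i IH] //; case: i IH => [|i] IH // is_; rewrite /= IH ?andbT; last by lia.
by apply: spokes_touch; lia.
Qed.

Lemma covered_spokes x i j : 0 < i < j -> j <= s ->
  covered (medge x (x + zigzag j) :: spokes x j.-1)
    [:: x %% k; (x + zigzag i) %% k; (x + zigzag i.+1) %% k].
Proof.
elim: j => [|j IH]; first by lia.
case: j IH => [|j] IH /=; first by lia.
move=> /andP[i0]; rewrite ltnS leq_eqVlt => /predU1P[-> _|ij js].
  by apply: covered_head; rewrite /= /joint !inE !eqxx ?orbT.
by apply: covered_cons; apply: IH; lia.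
Qed.

Definition seg x f := rcons (spokes x s.-1) f.

Lemma segE x f : seg x f = medge x (x + zigzag s.-1) :: rcons (spokes x s.-2) f.
Proof. by rewrite /seg /s; case: (p) p3 => [|[|[|r]]]. Qed.

Lemma size_seg x f : size (seg x f) = s.
Proof. by rewrite size_rcons size_spokes /s; lia. Qed.

Lemma last_seg e x f : last e (seg x f) = f.
Proof. by rewrite last_rcons. Qed.

Lemma path_seg x f : touch (medge x (x + zigzag 1)) f -> path touch (inner x) (seg x f).
Proof.
move=> tf; rewrite segE /= rcons_path path_spokes ?last_spokes ?tf ?andbT; try by rewrite /s; lia.
have b := mid_bounds; rewrite /inner.
case: zigzag_top => [[-> _]|[-> _]].
  by case: (@touch_medge (x + mid) (x + mid.+1) x); try (apply: neq_mod; lia).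
by case: (@touch_medge (x + mid.+1) (x + mid) x); try (apply: neq_mod; lia).
Qed.

Lemma centre_seg x f :
  covered [:: medge x (x + zigzag 1); f] [:: x %% k; (x + zigzag 0) %% k; (x + zigzag 1) %% k] ->
  centre (inner x :: seg x f) x.
Proof.
move=> cf i; rewrite leq_eqVlt => /predU1P[iE|is_].
  have -> : i = s.-1 by rewrite -iE.
  have -> : s.-1.+1 = s by rewrite -iE.
  rewrite segE; apply: covered_head.
  by case: zigzag_top => [] [-> ->]; rewrite /= /joint /inner !inE !eqxx ?orbT.
apply: covered_cons; rewrite segE -cats1; case: i is_ => [|i] is_.
  by apply: covered_cat_last; rewrite last_spokes // /s; lia.
by apply/covered_cat_head/covered_spokes; lia.
Qed.

Lemma zigzag0 : zigzag 0 = L. Proof. by rewrite /zigzag addn0. Qed.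
Lemma zigzag1 : zigzag 1 = L + s. Proof. by rewrite /zigzag subn0. Qed.

(** Moving the centre by [pitch] turns the inner edge into {x + L + s, x + L + p}, which meets
    [closeO x] in x + L + s. The triangle at the junction supplies an edge of class [p]. *)
Lemma segO x : [/\ path touch (inner x) (seg x (closeO x)), 
  centre (inner x :: seg x (closeO x)) x, touch (closeO x) (inner (x + pitch)) &
  covered [:: closeO x; inner (x + pitch)] [:: (x + L) %% k; (x + L + p) %% k]].
Proof.
have E : x + pitch + mid = x + L + s by have := mid_pitch; lia.
have E' : x + pitch + mid.+1 = x + L + p by have := mid_pitch; rewrite /s; lia.
have sE : s.+1 = p by rewrite /s; lia.
split.
- apply: path_seg; rewrite zigzag1 /closeO.
  by rewrite addnA; case: (@touch_medge (x + L + s) x (x + L)); try (apply: neq_mod; lia).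
- apply: centre_seg; apply: covered_head.
  by rewrite zigzag0 zigzag1 /= /joint /closeO /medge !inE !eqxx ?orbT.
- rewrite /closeO /inner E E'.
  by case: (@touch_medge (x + L + s) (x + L) (x + L + p)); try (apply: neq_mod; lia).
apply: covered_head; rewrite /closeO /inner E'.
by rewrite /= /joint !inE !eqxx ?orbT.
Qed.

Lemma segL x : path touch (inner x) (seg x (closeL x)) /\
  centre (inner x :: seg x (closeL x)) x.
Proof.
have sE : s.+1 = p by rewrite /s; lia.
split.
  by apply: path_seg; rewrite /closeL -zigzag0; apply: spokes_touch; lia.
apply: centre_seg; apply: covered_head.
by rewrite zigzag0 zigzag1 /= /joint !inE !eqxx ?orbT.
Qed.

(** * Chains of translated fans *)

Section Chain.
Variables (cl : nat -> nat * nat) (r : nat) (lk : nat -> seq nat).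
Hypothesis clP : forall x, [/\ path touch (inner x) (seg x (cl x)),
  centre (inner x :: seg x (cl x)) x, touch (cl x) (inner (x + r)) &
  covered [:: cl x; inner (x + r)] (lk x)].

(** A chain of [m.+1] fans without its opening edge [inner x]. The last fan ends with a spoke, so a
    link follows every fan but the last. *)
Fixpoint cyc x m := if m is m'.+1 then seg x (cl x) ++ inner (x + r) :: cyc (x + r) m'
  else seg x (closeL x).

Lemma size_cyc x m : (size (cyc x m)).+1 = m.+1 * p.
Proof.
have sE : s.+1 = p by rewrite /s; lia.
elim: m x => [|m IH] x /=; first by rewrite size_seg sE mul1n.
by rewrite size_cat /= IH size_seg; lia.
Qed.

Lemma last_cyc e x m : last e (cyc x m) = closeL (x + m * r).
Proof.
elim: m e x => [|m IH] e x /=; first by rewrite last_seg mul0n addn0.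
by rewrite last_cat /= IH mulSn addnA.
Qed.

Lemma path_cyc x m : path touch (inner x) (cyc x m).
Proof.
elim: m x => [|m IH] x /=; first by case: (segL x).
by case: (clP x) => ps _ tc _; rewrite cat_path ps last_seg /= tc IH.
Qed.

Lemma centre_cyc x m j : j <= m -> centre (inner x :: cyc x m) (x + j * r).
Proof.
elim: m x j => [|m IH] x j /=.
  by rewrite leqn0 => /eqP->; rewrite addn0; case: (segL x).
have [_ cs _ _] := clP x.
case: j => [_|j jm] i is_; first by rewrite addn0; apply/covered_cat_head/cs.
by rewrite mulSn addnA; apply/covered_cat_last/covered_cons/IH.
Qed.

Lemma link_cyc x m j : j < m -> covered (inner x :: cyc x m) (lk (x + j * r)).
Proof.
elim: m x j => [|m IH] x j //=.
have [_ _ _ cl'] := clP x.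
case: j => [_|j jm]; last by rewrite mulSn addnA; apply/covered_cat_last/covered_cons/IH.
rewrite addn0; apply: covered_cat_last; rewrite last_seg.
by apply: (covered_catr (cyc (x + r) m)) cl'.
Qed.

Hypothesis cl_lt : forall x, below (cl x).

Lemma below_seg x f : below f -> all below (seg x f).
Proof.
by move=> bf; rewrite all_rcons bf /=; elim: (s.-1) => //= i ->; rewrite below_medge.
Qed.

Lemma below_cyc x m : all below (cyc x m).
Proof.
elim: m x => [|m IH] x /=; first by rewrite below_seg ?below_medge.
by rewrite all_cat below_seg //= below_medge IH.
Qed.
End Chain.

Lemma centre_mod es x y : x = y %[mod k] -> centre es x -> centre es y.
Proof. by move=> E H i /H; rewrite -!(eq_modDr _ E) E. Qed.

Definition class es c := forall v, covered es [:: v %% k; (v + c) %% k].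

Lemma class_spoke es c : (forall x, centre es x) -> L <= c < L + p -> class es c.
Proof.
move=> ce cL v; have [|i is_ <-] := @zigzag_surj c; first by rewrite /s; lia.
have [lt|ge] := ltnP i s.
  by apply: covered_sub (ce v i lt) => w; rewrite !inE => /orP[]->; rewrite ?orbT.
have -> : i = s.-1.+1 by rewrite /s in is_ ge *; lia.
have lt : s.-1 < s by rewrite /s; lia.
by apply: covered_sub (ce v _ lt) => w; rewrite !inE => /orP[]->; rewrite ?orbT.
Qed.

Lemma class_rim es c : (forall x, centre es x) -> 0 < c < p -> class es c.
Proof.
move=> ce cp v; have [|i is_ [a ac]] := @zigzag_rim c; first by rewrite /s; lia.
(* The rim edge {v, v + c} lies in the fan centred at v - a. *)
have := ce (v + a * k.-1) i is_.
rewrite -(eq_mod_shift v a) -(eq_modDr c (eq_mod_shift v a)).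
by case: ac => [] [-> ->]; rewrite ?addnA; apply: covered_sub=> w;
  rewrite !inE => /orP[]->; rewrite ?orbT.
Qed.

Lemma link_mod es x y : x = y %[mod k] -> link es x -> link es y.
Proof. by move=> E; rewrite /link -!addnA -!(eq_modDr _ E). Qed.

Lemma class_link es : (forall x, link es x) -> class es p.
Proof.
move=> le v; have := le (v + L * k.-1).
by rewrite /link -(eq_mod_shift v L) -(eq_modDr p (eq_mod_shift v L)).
Qed.

(** * Detours through finite fans inside a fan at infinity *)

Section Detours.
Variables (t m g I : nat).
Hypotheses (tE : t = p + L + 1) (kE : k.+1 = t.*2) (gE : g = gcdn k pitch) (mE : m.+1 * g = k).
Hypothesis (Ik : k <= I).

Let z x := x + mid.

(* The detour leaves the fan of [I] at [z], runs through a closed chain of finite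
   fans and rejoins the fan of [I] at [z + 2]; since [2 t = k + 1], it has then
   also used up the four edges [{v, v + t}] for [v = z, z + t, z + 2 t, z + 3 t]. *)
Definition detour x := medge (z x) (z x + t) :: inner x :: cyc closeO pitch x m ++
  [:: medge (z x).+1 ((z x).+1 + t); (I, ((z x).+1 + t) %% k); (I, (z x).+2 %% k)].

Lemma neq_inf a : I != a %% k.
Proof. by have := ltn_pmod a k0; lia. Qed.

Lemma touch_inf a b c : a %% k != b %% k -> a %% k = c %% k ->
  [/\ touch (I, c %% k) (medge a b), touch (I, c %% k) (medge b a),
     touch (medge a b) (I, c %% k) & touch (medge b a) (I, c %% k)].
Proof.
move=> ab <-; split.
- by case: (@touchP (a %% k) I (b %% k)); rewrite ?neq_inf // eq_sym neq_inf.
- by case: (@touchP (a %% k) I (b %% k)); rewrite ?neq_inf // eq_sym neq_inf.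
- by case: (@touchP (a %% k) (b %% k) I); rewrite ?neq_inf // eq_sym neq_inf.
by case: (@touchP (a %% k) (b %% k) I); rewrite ?neq_inf // eq_sym neq_inf.
Qed.

Lemma touch_inf2 a b : a %% k != b %% k -> touch (I, a %% k) (I, b %% k).
Proof. by move=> ab; case: (@touchP I (a %% k) (b %% k)); rewrite // neq_inf. Qed.

(** Since [m.+1 * pitch] is a multiple of [k], the last centre is x - pitch, which is the residue of
    [(z x).+1 + t]. The triangle after the last spoke therefore contains the link that the last fan
    still lacks. *)
Lemma detour_exit x :
  (z x).+1 + t = x + m * pitch %[mod k] /\ (z x).+1 = x + m * pitch + L + p %[mod k].
Proof.
have E1 : (z x).+1 + t = x + m * pitch %[mod k].
  apply: (@eq_mod_cancelr _ _ pitch).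
  have -> : (z x).+1 + t + pitch = x + 1 * k by have := mid_pitch; rewrite /z /s; lia.
  have -> : x + m * pitch + pitch = x + pitch %/ g * k.
    by rewrite -mE mulnCA divnK ?gE ?dvdn_gcdr //; lia.
  by rewrite !(eq_mod_addM erefl).
split=> //; apply: (@eq_mod_cancelr _ _ t); rewrite E1; apply/esym.
by apply: (@eq_mod_addM _ _ 1); lia.
Qed.

Lemma size_detour x : size (detour x) = k %/ g * p + 4.
Proof.
have g0 : 0 < g by case: (g) mE => //; lia.
rewrite /= size_cat /= -mE mulnK //.
by have := size_cyc closeO pitch x m; lia.
Qed.

Lemma last_detour e x : last e (detour x) = (I, (z x).+2 %% k).
Proof. by rewrite /= last_cat. Qed.

Lemma path_detour x : path touch (I, z x %% k) (detour x).
Proof.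
have [E1 E2] := detour_exit x; have := mid_bounds => cb.
rewrite /detour /= cat_path (path_cyc segO).
rewrite last_cyc /closeL /=; apply/and5P; split=> //.
- by case: (@touch_inf (z x) (z x + t) (z x)) => //; apply: neq_mod; lia.
- rewrite /inner addnS -/(z x).
  by case: (@touch_medge (z x) (z x + t) (z x).+1) => //; apply: neq_mod; lia.
- rewrite /medge E1 E2 -/(medge _ _) -/(medge _ _).
  by case: (@touch_medge (x + m * pitch) (x + m * pitch + L) (x + m * pitch + L + p)) => //;
    apply: neq_mod; lia.
- by case: (@touch_inf ((z x).+1 + t) (z x).+1 ((z x).+1 + t)) => //; apply: neq_mod; lia.
by rewrite andbT; apply: touch_inf2; apply: neq_mod; lia.
Qed.

Lemma below_detour (n : nat) x : I < n ->
  all (fun e => (e.1 < n) && (e.2 < n)) (detour x).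
Proof.
move=> In; have up a : a %% k < n by have := ltn_pmod a k0; lia.
rewrite /= !up /= all_cat /= In !up /= andbT; apply/allP=> e.
move/(allP (below_cyc pitch (fun x => below_medge (x + L) (x + L + s)) x m))/andP=> [h1 h2].
by apply/andP; split; lia.
Qed.

Lemma centre_detour x j : j <= m -> centre ((I, z x %% k) :: detour x) (x + j * pitch).
Proof.
by move=> jm i is_; do 2!apply: covered_cons; apply/covered_cat_head/(centre_cyc segO).
Qed.

Lemma link_detour x j : j <= m -> link ((I, z x %% k) :: detour x) (x + j * pitch).
Proof.
move=> jm; do 2!apply: covered_cons; have [lt|ge] := ltnP j m.
  exact/covered_cat_head/(link_cyc segO).
have -> : j = m by lia.
apply: covered_cat_last; rewrite last_cyc; apply: covered_head.
have [_ E2] := detour_exit x.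
by rewrite /= -E2 /joint /= !inE !eqxx ?orbT.
Qed.

Lemma add_double_t a : a + t.*2 = a.+1 %[mod k].
Proof. by apply: (@eq_mod_addM _ _ 1); lia. Qed.

Lemma detour_covers x r : r < 4 ->
  covered ((I, z x %% k) :: detour x) [:: I; (z x + r * t) %% k] /\
  covered ((I, z x %% k) :: detour x) [:: (z x + r * t) %% k; (z x + r.+1 * t) %% k].
Proof.
have e2 : z x + 2 * t = (z x).+1 %[mod k] by rewrite mul2n add_double_t.
have e3 : z x + 3 * t = (z x).+1 + t %[mod k].
  by rewrite -(eq_modDr t e2) -addnA; congr (_ %% _); lia.
have e4 : z x + 4 * t = (z x).+2 %[mod k].
  by rewrite -(add_double_t (z x).+1) -(eq_modDr t.*2 (add_double_t _)); congr (_ %% _); lia.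
have tail P : covered [:: medge (z x).+1 ((z x).+1 + t);
      (I, ((z x).+1 + t) %% k); (I, (z x).+2 %% k)] P ->
    covered ((I, z x %% k) :: detour x) P.
  by move=> c; do 2!apply: covered_cons; apply/covered_cat_last/covered_cons.
case: r => [|[|[|[|r]]]] // _; rewrite ?e2 ?e3 ?e4 ?mul0n ?mul1n ?addn0.
- by split; apply: covered_head; rewrite /= /joint /= !inE !eqxx ?orbT.
- split; first by apply: covered_head; rewrite /= /joint /= !inE !eqxx ?orbT.
  apply/covered_cons/covered_head.
  by rewrite /= /joint /= !inE addnS !eqxx ?orbT.
- split; apply: tail; apply: covered_head; by rewrite /= /joint /= !inE !eqxx ?orbT.
by split; apply/tail/covered_cons/covered_head; rewrite /= /joint /= !inE !eqxx ?orbT.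
Qed.

Fixpoint detours x i := if i is i'.+1 then detour x ++ detours x.+2 i' else [::].

Lemma detoursS x i : detours x i.+1 = detour x ++ detours x.+2 i.
Proof. by []. Qed.

Lemma z_add2 x : z x.+2 = (z x).+2.
Proof. by rewrite /z. Qed.

Lemma size_detours x i : size (detours x i) = i * (k %/ g * p + 4).
Proof. by elim: i x => // i IH x; rewrite detoursS size_cat IH size_detour. Qed.

Lemma last_detours x i : last (I, z x %% k) (detours x i) = (I, (z x + i.*2) %% k).
Proof.
elim: i x => [|i IH] x; first by rewrite addn0.
by rewrite detoursS last_cat last_detour -z_add2 IH z_add2 doubleS !addSnnS.
Qed.

Lemma path_detours x i : path touch (I, z x %% k) (detours x i).
Proof.
elim: i x => // i IH x.
by rewrite detoursS cat_path path_detour last_detour -z_add2 IH.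
Qed.

Lemma below_detours (n : nat) x i : I < n ->
  all (fun e => (e.1 < n) && (e.2 < n)) (detours x i).
Proof.
by move=> In; elim: i x => // i IH x; rewrite detoursS all_cat IH andbT; apply: below_detour.
Qed.

Lemma centre_detours x i j l : l < i -> j <= m ->
  centre ((I, z x %% k) :: detours x i) (x + l.*2 + j * pitch).
Proof.
elim: i x l => // i IH x [_|l li] jm u us.
  by rewrite addn0; apply/covered_cat_head/centre_detour.
rewrite doubleS !addnS -!addSn.
by apply: covered_cat_last; rewrite last_detour -z_add2; apply: IH.
Qed.

Lemma link_detours x i j l : l < i -> j <= m ->
  link ((I, z x %% k) :: detours x i) (x + l.*2 + j * pitch).
Proof.
elim: i x l => // i IH x [_|l li] jm.
  by rewrite addn0; apply/covered_cat_head/link_detour.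
rewrite doubleS !addnS -!addSn.
by apply: covered_cat_last; rewrite last_detour -z_add2; apply: IH.
Qed.

(** A detour takes four steps by [t], and 4 t = 2 k + 2 moves the base point by two. *)
Lemma add_quad_t a j : a + (4 + j) * t = a.+2 + j * t %[mod k].
Proof. by apply: (@eq_mod_addM _ _ 2); nia. Qed.

Lemma detours_cover x i r : r < 4 * i ->
  covered ((I, z x %% k) :: detours x i) [:: I; (z x + r * t) %% k] /\
  covered ((I, z x %% k) :: detours x i) [:: (z x + r * t) %% k; (z x + r.+1 * t) %% k].
Proof.
elim: i x r => [|i IH] x r ri; first by lia.
have [r4|r4] := ltnP r 4.
  by have [h1 h2] := detour_covers x r4; split; apply: covered_cat_head.
have -> : r = 4 + (r - 4) by lia.
rewrite -addnS !add_quad_t -z_add2; have [|h1 h2] := IH x.+2 (r - 4); first by lia.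
by split; apply: covered_cat_last; rewrite last_detour -z_add2.
Qed.

(* One chain reaches the centres of a coset of the multiples of [g], which is odd,
   so [g] detours at distance two from each other reach all of them. *)
Definition tfan x := detours x g ++
  fan I [seq (z x + g.*2 + j * t) %% k | j <- iota 1 (k.-1 - 4 * g)].

(** [g] divides [pitch], hence 4 g <= 2 p < k: the detours use up less than one turn of the cycle of
    steps by [t]. *)
Lemma detours_room : 0 < g /\ 4 * g < k.
Proof.
have : 0 < g by case: (g) mE => //; lia.
have : g <= pitch by rewrite gE dvdn_leq ?dvdn_gcdr // /pitch; lia.
by rewrite /pitch; lia.
Qed.

Lemma size_tfan x : (size (tfan x)).+1 = k + k * p.
Proof.
have [g0 gk] := detours_room.
rewrite size_cat size_detours !size_map size_iota mulnDr mulnA [g * _]mulnC divnK;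
  last by rewrite -mE dvdn_mull.
by rewrite mulnC; lia.
Qed.

Lemma add_tg a j : a + g.*2 + j * t = a + (4 * g + j) * t %[mod k].
Proof.
apply/esym; elim: (g) a => [|i IH] a; first by rewrite muln0 add0n addn0.
by rewrite mulnS -addnA add_quad_t IH; congr (_ %% _); lia.
Qed.

Lemma tfan_fan x :
  let vs := [seq (z x + g.*2 + j * t) %% k | j <- iota 0 (k - 4 * g)] in
  (I, (z x + g.*2) %% k) ::
    fan I [seq (z x + g.*2 + j * t) %% k | j <- iota 1 (k.-1 - 4 * g)] = fan I vs.
Proof.
have [g0 gk] := detours_room.
have -> : k - 4 * g = (k.-1 - 4 * g).+1 by lia.
by rewrite /= mul0n addn0.
Qed.

Lemma path_tfan x : path touch (I, z x %% k) (tfan x).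
Proof.
rewrite cat_path path_detours last_detours; apply: path_fan; first exact: neq_inf.
  by apply/allP=> w /mapP[j _ ->]; apply: neq_inf.
have -> : (z x + g.*2) %% k = (z x + g.*2 + 0 * t) %% k by rewrite addn0.
move: (k.-1 - 4 * g) => N; elim: N 0 => //= n IH j; rewrite IH andbT.
by apply: neq_mod; lia.
Qed.

Lemma last_tfan x : last (I, z x %% k) (tfan x) = (I, (z x + k.-1 * t) %% k).
Proof.
have [g0 gk] := detours_room.
rewrite last_cat last_detours.
have -> : k.-1 = 4 * g + (k.-1 - 4 * g) by lia.
rewrite -add_tg addKn.
case: (k.-1 - _) => [|n]; first by rewrite /= addn0.
have -> : iota 1 n.+1 = rcons (iota 1 n) n.+1 by rewrite -[RHS]cats1 -add1n -(iotaD 1 n 1) addn1.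
by rewrite /fan !map_rcons last_rcons.
Qed.

Lemma below_tfan (n : nat) x : I < n ->
  all (fun e => (e.1 < n) && (e.2 < n)) (tfan x).
Proof.
move=> In; rewrite all_cat below_detours //=; apply/allP=> e /mapP[v /mapP[j _ ->] ->] /=.
by rewrite In (leq_trans (ltn_pmod _ k0)) // ltnW // (leq_ltn_trans Ik).
Qed.

Lemma tfan_residue w : exists l j, [/\ l < g, j <= m & l.*2 + j * pitch = w %[mod k]].
Proof.
have [g0 gk] := detours_room.
have og : odd g.
  have ok : odd k by lia.
  by move: ok; rewrite -mE oddM => /andP[].
(* [uphalf g] is the inverse of 2 modulo the odd number [g]. *)
pose l := (w * uphalf g) %% g.
have lg : l < g by rewrite ltn_mod.
have l2 : l.*2 = w %[mod g].
  rewrite -muln2 modnMml -mulnA muln2.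
  have -> : (uphalf g).*2 = g + 1 by lia.
  by rewrite mulnDr muln1 addnC -modnDmr modnMl addn0.
have /dvdnP[e eE] : g %| w + l.*2 * k.-1.
  rewrite /dvdn -modnDml -l2 modnDml; apply/eqP.
  have -> : l.*2 + l.*2 * k.-1 = l.*2 * m.+1 * g by rewrite -mulnA mE; nia.
  by rewrite modnMl.
have [a _ /dvdnP[b bE]] := @Bezoutl k pitch k0; rewrite -gE in bE.
(* Bezout gives a pitch = -g modulo [k], so j pitch = e g = w - 2 l. Reducing [j] modulo [m.+1] is
   harmless because [m.+1 * pitch] vanishes modulo [k]. *)
pose j := k.-1 * a * e.
exists l, (j %% m.+1); split=> //; first by rewrite -ltnS ltn_mod.
have jq : j %% m.+1 * pitch = j * pitch %[mod k].
  have mq : m.+1 * pitch = pitch %/ g * k by rewrite -mE mulnCA divnK ?gE ?dvdn_gcdr.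
  apply/esym; apply: (@eq_mod_addM _ _ (j %/ m.+1 * (pitch %/ g))).
  by rewrite {1}(divn_eq j m.+1) mulnDl -!mulnA mq addnC.
rewrite -modnDmr jq modnDmr.
apply: (@eq_mod_cancelr _ _ (l.*2 * k.-1)); rewrite eE.
apply: (@eq_mod_cancelr _ _ (e * (k.-1 * g))).
rewrite (@eq_mod_addM _ 0 (l.*2 + k.-1 * e * b)); last first.
  have : k.-1 * e * (g + a * pitch) = k.-1 * e * (b * k) by rewrite bE.
  have : l.*2 * k = l.*2 + l.*2 * k.-1 by rewrite -mulnS prednK.
  by rewrite /j; move: k.-1 (l.*2) => K l'; lia.
apply/esym; apply: (@eq_mod_addM _ _ (e * g)).
have : e * g * k = e * g + e * g * k.-1 by rewrite -mulnS prednK.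
by rewrite add0n => ->; rewrite [k.-1 * g]mulnC mulnA.
Qed.

Lemma centre_tfan x y : centre ((I, z x %% k) :: tfan x) y.
Proof.
have [l [j [lg jm lj]]] := tfan_residue (y + x * k.-1).
apply: (@centre_mod _ (x + l.*2 + j * pitch)).
  by rewrite -addnA addnC (eq_modDr x lj) eq_mod_shift.
by move=> i is_; apply/covered_cat_head/centre_detours.
Qed.

Lemma link_tfan x y : link ((I, z x %% k) :: tfan x) y.
Proof.
have [l [j [lg jm lj]]] := tfan_residue (y + x * k.-1).
apply: (@link_mod _ (x + l.*2 + j * pitch)).
  by rewrite -addnA addnC (eq_modDr x lj) eq_mod_shift.
exact/covered_cat_head/link_detours.
Qed.

Lemma tfan_edge x j : j < k.-1 ->
  covered ((I, z x %% k) :: tfan x) [:: (z x + j * t) %% k; (z x + j.+1 * t) %% k].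
Proof.
move=> jk; have [lt|ge] := ltnP j (4 * g).
  by have [_ h] := detours_cover x lt; apply: covered_cat_head.
apply: covered_cat_last; rewrite last_detours tfan_fan.
have -> : j = 4 * g + (j - 4 * g) by lia.
rewrite -addnS -!add_tg; set i := j - 4 * g; have ik : i.+1 < k - 4 * g by lia.
set vs := map _ _.
have sv : size vs = k - 4 * g by rewrite size_map size_iota.
have := @fan_consec I vs (nth 0 vs i) (nth 0 vs i.+1) (consec_nth _ _); rewrite sv => /(_ ik).
rewrite !(nth_map 0) ?size_iota ?(ltnW ik) // !nth_iota ?(ltnW ik) // !add0n.
by apply: covered_sub => w; rewrite !inE => ->; rewrite orbT.
Qed.

(** Since 2 t = 1 modulo [k], the index is 2 (v - z). *)
Lemma tfan_index x v : exists2 j, j < k & v %% k = (z x + j * t) %% k.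
Proof.
pose w := v + z x * k.-1; pose j := w.*2 %% k.
exists j; first by rewrite ltn_mod.
rewrite /j -modnDmr modnMml modnDmr -doubleMl doubleMr -kE; apply/esym.
apply: (@eq_mod_addM _ _ (w + z x)); rewrite mulnS mulnDl.
by have : z x * k = z x + z x * k.-1 by [rewrite -mulnS prednK]; rewrite /w => ->; lia.
Qed.

Lemma tfan_spoke x v : covered ((I, z x %% k) :: tfan x) [:: I; v %% k].
Proof.
have [g0 gk] := detours_room; have [j jk ->] := tfan_index x v.
have [lt|ge] := ltnP j (4 * g).
  by have [h _] := detours_cover x lt; apply: covered_cat_head.
have [jl|jl] := ltnP j k.-1.
  apply: covered_cat_last; rewrite last_detours tfan_fan.
  have -> : j = 4 * g + (j - 4 * g) by lia.
  rewrite -!add_tg; apply: fan_mem; first by rewrite size_map size_iota; lia.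
  by apply/map_f; rewrite mem_iota; lia.
have -> : j = k.-1 by lia.
have := mem_last (I, z x %% k) (tfan x); rewrite last_tfan => /covered_mem; apply.
by rewrite /= size_tfan; nia.
Qed.

(** As t = -(p + L) modulo [k], the class [p + L] consists of the [k] steps by [t]; the exception is
    the step that would close the cycle. *)
Lemma tfan_class x v : covered ((I, z x %% k) :: tfan x) [:: v %% k; (v + (p + L)) %% k] \/
  (v %% k = z x %% k /\ (v + (p + L)) %% k = (z x + k.-1 * t) %% k).
Proof.
have [j jk jE] := tfan_index x (v + (p + L)).
have vE : v %% k = (z x + j.+1 * t) %% k.
  rewrite mulSn [t + _]addnC addnA -(eq_modDr t jE); apply/esym.
  by apply: (@eq_mod_addM _ _ 1); lia.
have [lt|ge] := ltnP j k.-1.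
  by left; rewrite jE vE; apply/coveredC/tfan_edge.
have jE' : j = k.-1 by lia.
rewrite jE' prednK // in jE vE; right; split=> //.
by rewrite vE mulnC; apply: (@eq_mod_addM _ _ t).
Qed.

(** The classes are the rims below [p], the links [p], those between [p] and [L] left to the
    hypothesis, the spokes from [L] to L + p - 1, and finally p + L. *)
Lemma tfan_pairs x es :
  (forall vs, covered ((I, z x %% k) :: tfan x) vs -> covered es vs) ->
  (forall c, p < c < L -> class es c) -> forall a b, a < b < k ->
  covered es [:: a; b] \/ (a = z x %% k /\ b = (z x + k.-1 * t) %% k) \/
    (b = z x %% k /\ a = (z x + k.-1 * t) %% k).
Proof.
move=> sub cD a b ab; have ok : odd k by lia.
have [v [c [ck vk E]]] := pair_class ok ab.
suff : covered es [:: v %% k; (v + c) %% k] \/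
    (v %% k = z x %% k /\ (v + c) %% k = (z x + k.-1 * t) %% k).
  case: E => [] [-> ->]; last by case=> [/coveredC|]; [left|right; right].
  by case=> [|]; [left|right; left].
have ce y : centre es y by move=> i /(@centre_tfan x y)/sub.
have [cp|cp] := ltnP c p; first by left; apply: class_rim ce _ _; lia.
have [->|cp'] := eqVneq c p; first by left; apply: class_link => y; apply/sub/link_tfan.
have [cL|cL] := ltnP c L; first by left; apply: cD; lia.
have [cL'|cL'] := ltnP c (L + p); first by left; apply: class_spoke ce _ _; lia.
have -> : c = p + L by lia.
by case: (tfan_class x v) => [/sub|]; [left|right].
Qed.
End Detours.
End Cyclic.

(** Quantifying over a larger strip [es] lets each application cover the classes between [p] and [L]
    with the rest of its strip. Besides these, the only doubtful pair of residues is {z0, z0 + p +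
    L}. *)
Lemma tfanP k p L I z0 : 2 < p -> 0 < L -> k = (p + L).*2.+1 -> k <= I ->
  exists F, [/\ path touch (I, z0 %% k) F, (size F).+1 = k + k * p,
    last (I, z0 %% k) F = (I, (z0 + (p + L)) %% k),
    forall n, I < n -> all (fun e => (e.1 < n) && (e.2 < n)) F &
    forall es, (forall vs, covered ((I, z0 %% k) :: F) vs -> covered es vs) ->
      (forall v, covered es [:: I; v %% k]) /\
      ((forall c, p < c < L -> class k es c) -> forall a b, a < b < k ->
        covered es [:: a; b] \/ (a = z0 %% k /\ b = (z0 + (p + L)) %% k) \/
        (b = z0 %% k /\ a = (z0 + (p + L)) %% k))].
Proof.
move=> p3 L0 kE Ik.
have k0 : 0 < k by lia.
have Lk : L + p < k by lia.
pose t := p + L + 1; have tE : t = p + L + 1 by [].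
have kE' : k.+1 = t.*2 by lia.
pose g := gcdn k (pitch p); have gE : g = gcdn k (pitch p) by [].
have g0 : 0 < g by rewrite gcdn_gt0 k0.
pose m := (k %/ g).-1.
have mE : m.+1 * g = k.
  by rewrite prednK ?divnK ?dvdn_gcdl // divn_gt0 // dvdn_leq // dvdn_gcdl.
pose x := z0 + mid p L * k.-1.
have zE : (x + mid p L) %% k = z0 %% k by rewrite /x; apply: eq_mod_shift.
have zE' : (x + mid p L + k.-1 * t) %% k = (z0 + (p + L)) %% k.
  rewrite (eq_modDr _ zE); apply: (@eq_mod_addM _ _ _ (p + L)); rewrite [(p + L) * k]mulnC.
  have : k * (p + L) = (p + L) + k.-1 * (p + L) by rewrite -mulSn prednK.
  by rewrite /t; lia.
exists (tfan k p L t m g I x); rewrite -zE -zE'; split.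
- exact: path_tfan.
- exact: size_tfan.
- exact: last_tfan.
- by move=> n In; apply: below_tfan.
move=> es sub; split; first by move=> v; apply/sub/tfan_spoke.
by move=> cD a b; apply: (tfan_pairs k0 p3 L0 Lk tE kE' gE mE Ik sub cD).
Qed.

(** * The four residue classes of n *)

Lemma strip_perfect n es :
  sorted touch es -> all (fun e => (e.1 < n) && (e.2 < n)) es ->
  (forall x y, x < y -> y < n -> covered es [:: x; y]) ->
  1 < size es -> (size es).*2 = 'C(n, 2).+1 -> ('C(n, 2) - 3)./2 <= Hs n 2.
Proof.
move=> se be cov s1 sz; have := @strip_Hs n es [::] se be s1.
rewrite addn0 sz leqnn => /(_ (fun x y xy yn => or_introl (cov x y xy yn)) isT).
by apply: leq_trans; lia.
Qed.

(** When the binomial C is even, one uncovered pair costs nothing: C / 2 - 2 is still the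
    rounded-down half of C - 3. *)
Lemma strip_but_one n es A B :
  sorted touch es -> all (fun e => (e.1 < n) && (e.2 < n)) es ->
  (forall x y, x < y -> y < n -> covered es [:: x; y] \/
    (x = A /\ y = B) \/ (y = A /\ x = B)) ->
  1 < size es -> (size es).*2 = 'C(n, 2) -> ('C(n, 2) - 3)./2 <= Hs n 2.
Proof.
move=> se be cov s1 sz; have := @strip_Hs n es [:: (minn A B, maxn A B)] se be s1.
rewrite addn1 sz leqnn => H; apply: leq_trans (H _ isT); first by lia.
move=> x y xy yn; have [|e] := cov x y xy yn; [by left|right].
by case: e => [] [-> ->] in xy *; rewrite mem_seq1; apply/eqP; congr pair; lia.
Qed.

(** * Vertex numbers 4p + 1: finite fans only *)

Section FourPlusOne.
Variables (p k L : nat).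
Hypotheses (p3 : 2 < p) (kE : k = 4 * p + 1) (LE : L = p + 1).
Let k0 : 0 < k. Proof. by rewrite kE addn1. Qed.
Let L0 : 0 < L. Proof. by rewrite LE addn1. Qed.
Let Lk : L + p < k. Proof. by rewrite LE kE; lia. Qed.

(** With L = p + 1 the classes 1, ..., 2 p are all rims, links or spokes. As [r] has the inverse
    [w], a chain of [k] fans visits every centre, and only the link after the last fan may be
    missing; [e] is the offset of the links. *)
Lemma strip_4p1 cl r lk (e w : nat) :
  (forall x, [/\ path touch (inner k p L x) (seg k p L x (cl x)),
     centre k p L (inner k p L x :: seg k p L x (cl x)) x,
     touch (cl x) (inner k p L (x + r)) &
     covered [:: cl x; inner k p L (x + r)] (lk x)]) ->
  (forall x, below k (cl x)) ->
  (forall x, lk x = [:: (x + e) %% k; (x + e + p) %% k]) ->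
  w * r = 1 %[mod k] -> ('C(k, 2) - 3)./2 <= Hs k 2.
Proof.
move=> clP cl_lt lkE wr; set es := inner k p L 0 :: cyc k p L cl r 0 k.-1.
have res v : exists2 j, j <= k.-1 & 0 + j * r = v %[mod k].
  exists ((v * w) %% k); first by rewrite -ltnS prednK // ltn_mod.
  by rewrite add0n modnMml -mulnA -modnMmr wr modnMmr muln1.
have ce x : centre k p L es x.
  have [j jk jE] := res x; apply: centre_mod jE _.
  exact: (centre_cyc k0 p3 L0 Lk clP).
have sz : size es = k * p.
  by rewrite /= (size_cyc k0 p3 L0 Lk) prednK.
have szC : (size es).*2 = 'C(k, 2).
  rewrite sz bin2 kE.
  have -> : (4 * p + 1) * (4 * p + 1).-1 = ((4 * p + 1) * p).*2.*2.
    by rewrite addn1 /=; lia.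
  by rewrite doubleK.
apply: (@strip_but_one k es ((k.-1 * r + e) %% k) ((k.-1 * r + e + p) %% k)) => //.
- exact: (path_cyc k0 p3 L0 Lk clP).
- apply/andP; split; first exact: below_medge.
  exact: below_cyc.
- move=> x y xy yk; have ok : odd k by rewrite kE; lia.
  have [|v [c [ck vk E]]] := @pair_class k k0 x y ok; first by rewrite xy.
  suff : covered es [:: v %% k; (v + c) %% k] \/
      (v %% k = (k.-1 * r + e) %% k /\ (v + c) %% k = (k.-1 * r + e + p) %% k).
    case: E => [] [-> ->]; last by case=> [/coveredC|]; [left|right; right].
    by case=> [|]; [left|right; left].
  have [cp|cp] := ltnP c p; first by left; apply: (class_rim k0 p3 L0 Lk ce); lia.
  have [->|cp'] := eqVneq c p; last by left; apply: (class_spoke k0 p3 L0 Lk ce); lia.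
  have [j jk jE] := res (v + e * k.-1).
  have vE : j * r + e = v %[mod k] by rewrite (eq_modDr e jE) eq_mod_shift.
  rewrite -(eq_modDr p vE) -vE.
  have [lt|ge] := ltnP j k.-1.
    by left; have := link_cyc clP 0 lt; rewrite lkE.
  by right; have -> : j = k.-1 by lia.
by rewrite sz; nia.
Qed.

Lemma Hs_4p1 : ('C(k, 2) - 3)./2 <= Hs k 2.
Proof.
have w1 : 8 * k.-1 * (k - mid p L) = 8 * (k - mid p L) * k.-1 by lia.
have w2 : 8 * k.-1 * pitch p = 8 * pitch p * k.-1 by lia.
have cb := mid_bounds k0 p3 L0 Lk.
(* For even [p], 8 pitch = k - 1. For odd [p], 8 pitch = k - 5 may share the factor 5 with [k]; the
   fans then end with [closeL] and the centre moves by -mid, where 8 mid = 3 k + 1. In both cases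
   the step has inverse -8. *)
case op : (odd p).
  apply: (@strip_4p1 (closeL k L) (k - mid p L)
    (fun x => [:: (x + 1) %% k; (x + 1 + p) %% k]) 1 (8 * k.-1)) => //.
  - move=> x; have [s1 s2] := segL k0 p3 L0 Lk x.
    have E1 : (x + (k - mid p L) + mid p L) %% k = x %% k by apply: (@eq_mod_addM _ _ _ 1); lia.
    have E2 : (x + (k - mid p L) + (mid p L).+1) %% k = (x + 1) %% k.
      by apply: (@eq_mod_addM _ _ _ 1); lia.
    split=> //; rewrite /inner /closeL /medge E1 E2.
      by case: (@touch_medge k x (x + L) (x + 1)) => //; apply: neq_mod; lia.
    have -> : x + 1 + p = x + L by lia.
    by apply: covered_head; rewrite /= /joint /= !inE !eqxx ?orbT.
  - by move=> x; apply: below_medge.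
  rewrite w1; apply: (@eq_mod_addM _ _ _ (5 * k - 6)).
  have E : 8 * (k - mid p L) = 5 * k - 1 by move: op; rewrite /mid; lia.
  have [K KE] : exists K, k = K.+2 by exists (4 * p - 1); lia.
  rewrite E KE; have -> : 5 * K.+2 - 1 = 5 * K + 9 by lia.
  by have -> : 5 * K.+2 - 6 = 5 * K + 4 by [lia]; rewrite /=; lia.
apply: (@strip_4p1 (closeO k p L) (pitch p)
  (fun x => [:: (x + L) %% k; (x + L + p) %% k]) L (8 * k.-1)) => //.
- exact: segO.
- by move=> x; apply: below_medge.
rewrite w2; apply: (@eq_mod_addM _ _ _ (k - 2)).
have -> : 8 * pitch p = k.-1 by move: op; rewrite /pitch; lia.
have [K ->] : exists K, k = K.+2 by exists (4 * p - 1); lia.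
by rewrite /= subn2 /=; lia.
Qed.
End FourPlusOne.

(** * Vertex numbers 4p + 4 and 4p + 7: one or two points at infinity *)

Lemma Hs_4p4 p n : 2 < p -> n = 4 * p + 4 -> ('C(n, 2) - 3)./2 <= Hs n 2.
Proof.
(* Here [L] is p + 1, so no class lies strictly between [p] and [L], and the single point [k] at
   infinity suffices. *)
move=> p3 nE; pose k := n.-1; have kE : k = (p + (p + 1)).*2.+1 by lia.
have [|F [pF sF _ bF cF]] := @tfanP k p (p + 1) k 0 p3 _ kE (leqnn k); first by lia.
have k0 : 0 < k by lia.
have [sp pr] := cF ((k, 0 %% k) :: F) (fun _ => id).
apply: (@strip_but_one n ((k, 0 %% k) :: F) (0 %% k) ((0 + (p + (p + 1))) %% k)) => //.
- by rewrite /= bF ?mod0n; lia.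
- move=> x y xy yn; have [yk|yk] := ltnP y k.
    by apply: pr; [lia|rewrite xy].
  left; have -> : y = k by lia.
  by have := sp x; rewrite (@modn_small x); [apply: coveredC|lia].
- by rewrite /= sF; lia.
rewrite /= sF bin2; have -> : n * n.-1 = (k + k * p).*2.*2 by nia.
by rewrite doubleK.
Qed.

(** Here [L] is p + 2. The fan of [k] covers the remaining class p + 1, and the fan of [k.+1] with
    its detours does the rest. *)
Lemma Hs_4p7 p n : 2 < p -> n = 4 * p + 7 -> ('C(n, 2) - 3)./2 <= Hs n 2.
Proof.
move=> p3 nE; pose k := n.-2; have kE : k = (p + (p + 2)).*2.+1 by lia.
have [||F [pF sF _ bF cF]] := @tfanP k p (p + 2) k.+1 0 p3 _ kE; [by lia|by lia|].
have k0 : 0 < k by lia.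
pose v j := (j * (p + 1)) %% k.
pose vs := [seq v j | j <- iota 2 k.-1].
(* The first triangle {v 0, v 1, v 2} covers {v 0, v 2} = {0, 2 p + 2}, the pair that [F] leaves
   open. *)
pose e0 := (v 0, v 1).
pose A := [:: (v 1, v 2)] ++ fan k vs.
have vsE : vs = v 2 :: [seq v j | j <- iota 3 k.-2] by rewrite /vs; case: (k) kE => [|[|K]] //; lia.
have lA e : last e A = (k, 0 %% k).
  rewrite last_cat /vs; have -> : k.-1 = k.-2 + 1 by lia.
  rewrite iotaD map_cat /fan map_cat last_cat /=; congr pair.
  have -> : 2 + k.-2 = k by lia.
  by rewrite /v modnMr mod0n.
set es := e0 :: A ++ (k.+1, 0 %% k) :: F.
have vk j : v j < k by rewrite ltn_mod.
have vstep j : v j != v j.+1 by apply: neq_mod => //; rewrite mulSn; lia.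
have pth : sorted touch es.
  have -> : sorted touch es = path touch e0 (A ++ (k.+1, 0 %% k) :: F) by [].
  rewrite cat_path lA /= pF andbT -andbA; apply/and3P; split.
  - have v02 : v 0 != v 2 by apply: neq_mod => //; lia.
    by case: (@touchP (v 1) (v 0) (v 2)); rewrite ?vstep // eq_sym vstep.
  - rewrite vsE /=; apply/andP; split.
      case: (@touchP (v 2) (v 1) k); rewrite ?vstep //; try (by rewrite neq_ltn vk).
      by rewrite eq_sym vstep.
    apply: path_fan; first by rewrite eq_sym neq_ltn vk.
      by apply/allP=> w /mapP[j _ ->]; rewrite eq_sym neq_ltn vk.
    by move: (k.-2) 2 => N; elim: N => //= N IH i; rewrite IH vstep.
  have := @touchP (0 %% k) k k.+1; rewrite mod0n => -[] //; lia.
have cvF ws : covered ((k.+1, 0 %% k) :: F) ws -> covered es ws.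
  by move=> c; apply: covered_cat_last; apply: covered_cons.
have cvA ws : covered (e0 :: A) ws -> covered es ws by apply: covered_cat_head.
have [sp pr] := cF es cvF.
have fn ws : covered (fan k vs) ws -> covered es ws.
  by move=> c; apply: cvA; do 2!apply: covered_cons.
have fanj j : 0 < j <= k -> covered es [:: k; v j].
  move=> jk; have [->|j1] := eqVneq j 1.
    apply: cvA; apply: covered_cons; rewrite /A vsE; apply: covered_head.
    by rewrite /= /joint /= !inE !eqxx ?orbT.
  apply: fn; apply: fan_mem; first by rewrite size_map size_iota; lia.
  by apply/map_f; rewrite mem_iota; lia.
have stepj j : j < k -> covered es [:: v j; v j.+1].
  move=> jk; have [->|j0] := eqVneq j 0.
    by apply/cvA/covered_head; rewrite /= /joint /= !inE !eqxx ?orbT.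
  have [->|j1] := eqVneq j 1.
    by apply/cvA/covered_head; rewrite /= /joint /= !inE !eqxx ?orbT.
  apply: fn; have j2 : (j - 2).+1 < size vs by rewrite size_map size_iota; lia.
  have := fan_consec k (consec_nth 0 j2); rewrite size_map size_iota in j2.
  rewrite !(nth_map 0) ?size_iota ?(ltnW j2) // !nth_iota ?(ltnW j2) //.
  have -> : 2 + (j - 2) = j by lia.
  have -> : 2 + (j - 2).+1 = j.+1 by lia.
  by apply: covered_sub => w; rewrite !inE => ->; rewrite orbT.
have kE2 : k = (4 * p + 3).+2 by lia.
have res w : exists2 j, j < k & w %% k = v j.
  (* The inverse of p + 1 is -4, as 4 (p + 1) = k - 1. *)
  exists ((w * (4 * k.-1)) %% k); first by rewrite ltn_mod.
  rewrite /v modnMml -mulnA; apply/esym; apply: (@eq_mod_addM _ _ _ (w * (k - 2))).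
  have : 4 * k.-1 * (p + 1) = 1 + (k - 2) * k by rewrite kE2 /= subn2 /=; lia.
  by move=> ->; rewrite mulnDr muln1 mulnA.
have szE : size es = (k + k * p) + k.+1.
  by rewrite /= size_cat /= sF size_map size_map size_iota; lia.
apply: (@strip_perfect n es) => //.
- rewrite /= all_cat /= bF ?andbT; last by lia.
  have vn j : v j < n by apply: leq_trans (vk j) _; lia.
  rewrite !vn /=; apply/and3P; split=> //.
    by apply/allP=> e /mapP[w /mapP[j _ ->] ->] /=; rewrite vn; lia.
  by rewrite ?mod0n; lia.
- move=> x y xy yn; have [yk|yk] := ltnP y k.
    have cD c : p < c < p + 2 -> class k es c.
      move=> cp w; have -> : c = p + 1 by lia.
      have [j jk jE] := res w; rewrite (eq_modDr _ (jE : _ = j * (p + 1) %[mod k])) jE.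
      by have -> : j * (p + 1) + (p + 1) = j.+1 * (p + 1) by [lia]; apply: stepj.
    have xyk : x < y < k by rewrite xy.
    have [//|E] := pr cD x y xyk.
    have c02 : covered es [:: v 0; v 2].
      by apply/cvA/covered_head; rewrite /= /joint /= !inE !eqxx ?orbT.
    have v0 : v 0 = 0 %% k by [].
    have v2 : v 2 = (0 + (p + (p + 2))) %% k by rewrite /v; congr (_ %% _); lia.
    rewrite -v0 -v2 in E; case: E => [] [-> ->] //.
    exact: coveredC.
  have [->|yk'] := eqVneq y k.+1.
    have [xk|xk] := ltnP x k.
      by have := sp x; rewrite (@modn_small x) //; apply: coveredC.
    have -> : x = k by lia.
    apply: covered_cat_last; rewrite lA; apply: covered_head.
    by rewrite /= /joint /= !inE !eqxx ?orbT.
  have yE : y = k by lia.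
  rewrite yE in xy *; apply: coveredC.
  have [j jk jE] := res x; rewrite modn_small // in jE; rewrite jE.
  have [j0|j0] := eqVneq j 0; last by apply: fanj; lia.
  have -> : v j = v k by rewrite j0 /v modnMr mod0n.
  by apply: fanj; lia.
rewrite szE bin2; have -> : n * n.-1 = ((k + k * p).*2 + k.*2.+1).*2.
  by rewrite kE2 (_ : n = (4 * p + 6).+1) /=; lia.
by rewrite doubleK; lia.
Qed.

(** * Vertex numbers 4p + 10: three points at infinity *)

Definition steps (f : nat -> nat) n a b := exists2 i, i.+1 < n &
  (f i = a /\ f i.+1 = b) \/ (f i = b /\ f i.+1 = a).

Lemma consec_mkseq (T : Type) (f : nat -> T) n i : i.+1 < n -> consec (mkseq f n) (f i) (f i.+1).
Proof.
move=> lt; have := @consec_nth _ (f 0) (mkseq f n) i.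
by rewrite size_mkseq !nth_mkseq ?(ltnW lt) //; apply.
Qed.

Lemma last_mkseq (T : Type) (f : nat -> T) n x : last x (mkseq f n.+1) = f n.
Proof. by rewrite /mkseq -addn1 iotaD map_cat last_cat. Qed.

Lemma covered_steps I (f : nat -> nat) n a b :
  steps f n a b -> covered (fan I (mkseq f n)) [:: a; b].
Proof.
move=> [i ilt H]; have c := fan_consec I (consec_mkseq f ilt).
case: H c => [] [-> ->]; apply: covered_sub => w; rewrite !inE => /orP[]->; by rewrite !orbT.
Qed.

Lemma path_mkseq (T : Type) (r : rel T) (f : nat -> T) n :
  (forall i, i.+1 < n.+1 -> r (f i) (f i.+1)) -> path r (f 0) (mkseq (fun i => f i.+1) n).
Proof.
elim: n f => // n IH f H; rewrite /mkseq /= H //= (iotaDl 1 0) -map_comp.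
by apply: (IH (fun i => f i.+1)) => i ilt; apply: H.
Qed.

Lemma mkseqS (T : Type) (f : nat -> T) n : mkseq f n.+1 = f 0 :: mkseq (fun i => f i.+1) n.
Proof. by rewrite /mkseq /= (iotaDl 1 0) -map_comp. Qed.

Lemma last_fan I (f : nat -> nat) n e : last e (fan I (mkseq f n.+1)) = (I, f n).
Proof. by rewrite /fan /mkseq -map_comp; apply: last_mkseq. Qed.

Section FourPlusTen.
Variables (p k n : nat) (f1 f2 : nat -> nat).
Hypotheses (p3 : 2 < p) (kE : k = 4 * p + 7) (nE : n = k + 3).
Hypotheses (f1_first : f1 0 = 1) (f1_last : f1 (k - 3) = k - 2).
Hypotheses (f2_first : f2 0 = k - 2) (f2_last : f2 k.-1 = 1).
Hypothesis f1_lt : forall i, i < k - 2 -> f1 i < k.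
Hypothesis f2_lt : forall i, i < k -> f2 i < k.
Hypothesis f1_step : forall i, i.+1 < k - 2 -> f1 i != f1 i.+1.
Hypothesis f2_step : forall i, i.+1 < k -> f2 i != f2 i.+1.
Hypothesis f1_onto : forall j, 0 < j < k.-1 -> exists2 i, i < k - 2 & f1 i = j.
Hypothesis f2_onto : forall j, j < k -> exists2 i, i < k & f2 i = j.
Hypothesis step1 : forall j, 0 < j < k - 2 ->
  steps f1 (k - 2) j j.+1 \/ steps f2 k j j.+1.
Hypothesis step3 : forall j, j < k -> j != k - 2 ->
  steps f1 (k - 2) j ((j + 3) %% k) \/ steps f2 k j ((j + 3) %% k).

(* The residues are indexed by [v j = j (p + 2)]. Index steps 1, 2 and 3 give the
   classes [p + 2], [2 p + 3] and [p + 1]; the second is covered by the fan of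
   [k + 2], and [f1], [f2] are the orders in which the fans of [k] and [k + 1] run
   through the indices to cover the other two. *)
Lemma strip_4p10 : ('C(n, 2) - 3)./2 <= Hs n 2.
Proof.
have k0 : 0 < k by lia.
have kE1 : k = (p + (p + 3)).*2.+1 by lia.
pose v j := (j * (p + 2)) %% k.
have [||F [pF sF lF bF cF]] := @tfanP k p (p + 3) k.+2 (1 * (p + 2)) p3 _ kE1; [by lia|by lia|].
rewrite -/(v 1) in pF sF lF bF cF.
have v1E : (1 * (p + 2) + (p + (p + 3))) %% k = v k.-1.
  apply/esym; apply: (@eq_mod_addM _ _ _ p.+1).
  have -> : k.-1 = 4 * p + 6 by lia.
  by rewrite kE; lia.
rewrite v1E in lF cF.
have vlt j : v j < k by rewrite ltn_mod.
have vmod a b : a = b %[mod k] -> v a = v b by move=> E; rewrite /v -modnMml E modnMml.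
have vK a : v a * 4 = a %[mod k].
  rewrite /v modnMml -mulnA; apply: (@eq_mod_addM _ _ _ a).
  have -> : (p + 2) * 4 = k.+1 by lia.
  by rewrite mulnS.
have vinj a b : a < k -> b < k -> a != b -> v a != v b.
  move=> ak bk; apply: contra => /eqP E; apply/eqP.
  by have := vK a; rewrite E vK !modn_small.
have res w : exists2 j, j < k & w %% k = v j.
  exists ((w * 4) %% k); first by rewrite ltn_mod.
  rewrite /v modnMml -mulnA; apply/esym; apply: (@eq_mod_addM _ _ _ w).
  have -> : 4 * (p + 2) = k.+1 by lia.
  by rewrite mulnS.
pose g1 i := v (f1 i); pose g2 i := v (f2 i).
(* The two triangles of [e0 :: A] cover the index steps by 1 from k - 2, k - 1 and 0, the step by 3
   from k - 2 to 1, and {v 1, v (k - 1)}, the pair that [F] leaves open. *)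
pose e0 := (v (k - 2), v 1).
pose A := [:: (v 1, v k.-1); (v 0, v 1)].
pose F1 := fan k (mkseq g1 (k - 2)).
pose F2 := fan k.+1 (mkseq g2 k).
(* The closing edge joins [k] to [k.+2] and to [v k.-1]. The fan of [k] runs only through the
   indices 1 to k - 2; index 0 is met on entering it. *)
pose G := (k.+2, v 1) :: F ++ [:: (k, v k.-1)].
pose es := e0 :: A ++ F1 ++ F2 ++ G.
have lA e : last e A = (v 0, v 1) by [].
have F1E : F1 = (k, v 1) :: fan k (mkseq (fun i => g1 i.+1) (k - 3)).
  have E : k - 2 = (k - 3).+1 by lia.
  by rewrite /F1 E mkseqS /= {1}/g1 f1_first.
have F2E : F2 = (k.+1, v (k - 2)) :: fan k.+1 (mkseq (fun i => g2 i.+1) k.-1).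
  have E : mkseq g2 k = v (k - 2) :: mkseq (fun i => g2 i.+1) k.-1.
    by rewrite -{1}(prednK k0) mkseqS {1}/g2 f2_first.
  by rewrite /F2 E.
have l1 e : last e F1 = (k, v (k - 2)).
  have E : k - 2 = (k - 3).+1 by lia.
  by rewrite /F1 E last_fan /g1 f1_last E.
have l2 e : last e F2 = (k.+1, v 1).
  have E : mkseq g2 k = mkseq g2 k.-1.+1 by rewrite prednK.
  by rewrite /F2 E last_fan /g2 f2_last.
have vn j : v j < n by apply: leq_trans (vlt j) _; lia.
have neI I a : k <= I -> I != v a by move=> kI; have := vlt a; lia.
have pth : sorted touch es.
  have -> : sorted touch es = path touch e0 (A ++ F1 ++ F2 ++ G) by [].
  rewrite !cat_path lA l1 l2; apply/and4P; split.
  - have h1 : v 1 != v (k - 2) by apply: vinj; lia.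
    have h2 : v 1 != v k.-1 by apply: vinj; lia.
    have h3 : v (k - 2) != v k.-1 by apply: vinj; lia.
    have h4 : v 1 != v 0 by apply: vinj; lia.
    have h5 : v k.-1 != v 0 by apply: vinj; lia.
    rewrite /=; apply/and3P; split=> //.
      by case: (touchP h1 h2 h3).
    by case: (touchP h2 h4 h5).
  - rewrite F1E /=; apply/andP; split.
      have h4 : v 1 != v 0 by apply: vinj; lia.
      by case: (@touchP (v 1) (v 0) k); rewrite // eq_sym neI.
    have E : v 1 = g1 0 by rewrite /g1 f1_first.
    rewrite E; apply: path_fan; first exact: neI.
      by apply/allP=> w /mapP[i _ ->]; apply: neI.
    apply: path_mkseq => i ik; apply: vinj; [apply: f1_lt|apply: f1_lt|apply: f1_step]; lia.
  - rewrite F2E /=; apply/andP; split.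
      by case: (@touchP (v (k - 2)) k k.+1); rewrite // ?(eq_sym (v _)) ?neI //; lia.
    have E : v (k - 2) = g2 0 by rewrite /g2 f2_first.
    rewrite E; apply: path_fan; first exact: neI.
      by apply/allP=> w /mapP[i _ ->]; apply: neI.
    apply: path_mkseq => i ik; apply: vinj; [apply: f2_lt|apply: f2_lt|apply: f2_step]; lia.
  rewrite /G /= cat_path pF lF /= andbT; apply/andP; split.
    by case: (@touchP (v 1) k.+1 k.+2); rewrite // ?(eq_sym (v _)) ?neI //; lia.
  by case: (@touchP (v k.-1) k.+2 k); rewrite // ?(eq_sym (v _)) ?neI //; lia.
have cA vs : covered (e0 :: A) vs -> covered es vs by apply: covered_cat_head.
have c1' vs : covered ((v 0, v 1) :: F1) vs -> covered es vs.
  by move=> c; apply: covered_cat_last; rewrite lA; apply: covered_cat_head.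
have c1 vs : covered F1 vs -> covered es vs by move=> c; apply/c1'/covered_cons.
have c2' vs : covered ((k, v (k - 2)) :: F2) vs -> covered es vs.
  move=> c; apply: covered_cat_last; rewrite lA; apply: covered_cat_last; rewrite l1.
  exact: covered_cat_head.
have c2 vs : covered F2 vs -> covered es vs by move=> c; apply/c2'/covered_cons.
have c3' vs : covered ((k.+1, v 1) :: G) vs -> covered es vs.
  move=> c; apply: covered_cat_last; rewrite lA; apply: covered_cat_last; rewrite l1.
  by apply: covered_cat_last; rewrite l2.
have c3 vs : covered ((k.+2, v 1) :: F) vs -> covered es vs.
  by move=> c; apply/c3'/covered_cons/covered_cat_head.
have c4 vs : covered [:: (k.+2, v k.-1); (k, v k.-1)] vs -> covered es vs.
  by move=> c; apply/c3'/covered_cons/covered_cat_last; rewrite lF.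
have [sp pr] := cF es c3.
have stv a b : steps f1 (k - 2) a b \/ steps f2 k a b -> covered es [:: v a; v b].
  case=> [] [i ik H].
    by apply/c1/covered_steps; exists i => //; case: H => [] [<- <-]; [left|right].
  by apply/c2/covered_steps; exists i => //; case: H => [] [<- <-]; [left|right].
have cD c : p < c < p + 3 -> class k es c.
  move=> cp w; have [->|c2n] := eqVneq c (p + 2).
    have [j jk jE] := res w; rewrite (eq_modDr _ (jE : _ = j * (p + 2) %[mod k])) jE.
    have -> : (j * (p + 2) + (p + 2)) %% k = v j.+1 by rewrite /v; congr (_ %% _); lia.
    have [j0|j0] := eqVneq j 0.
      by rewrite j0; apply/cA/covered_cons/covered_head; rewrite /= /joint /= !inE !eqxx ?orbT.
    have [jk2|jk2] := ltnP j (k - 2); first by apply/stv/step1; lia.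
    have [->|jk3] := eqVneq j (k - 2).
      have -> : (k - 2).+1 = k.-1 by lia.
      by apply/cA/covered_head; rewrite /= /joint /= !inE !eqxx ?orbT.
    have -> : j = k.-1 by lia.
    have -> : v k.-1.+1 = v 0 by apply: vmod; rewrite prednK // modnn mod0n.
    by apply/cA/covered_cons/covered_head; rewrite /= /joint /= !inE !eqxx ?orbT.
  have -> : c = p + 1 by lia.
  have [j jk jE] := res (w + (p + 1)).
  have wE : w %% k = v (j + 3).
    rewrite /v mulnDl -(eq_modDr (3 * (p + 2)) (jE : _ = j * (p + 2) %[mod k])).
    by apply/esym; apply: (@eq_mod_addM _ _ _ 1); lia.
  rewrite wE jE; apply: coveredC; have [->|jk2] := eqVneq j (k - 2).
    have -> : v (k - 2 + 3) = v 1 by apply: vmod; apply: (@eq_mod_addM _ _ _ 1); lia.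
    by apply/cA/covered_head; rewrite /= /joint /= !inE !eqxx ?orbT.
  have -> : v (j + 3) = v ((j + 3) %% k) by apply: vmod; rewrite modn_mod.
  exact/stv/step3.
have szE : size es = 3 * k + 2 + k * p.
  rewrite /es /= !size_cat /= !size_map !size_iota size_cat /=.
  by move: sF; lia.
apply: (@strip_perfect n es) => //.
- rewrite /es /= !all_cat /= all_cat /= !vn bF ?andbT /=; last by lia.
  have kn : [&& k < n, k.+1 < n & k.+2 < n] by lia.
  have [kn1 kn2 kn3] := and3P kn; rewrite kn1 kn3 !andbT.
  apply/andP; split; apply/allP=> e /mapP[w /mapP[j _ ->] ->] /=.
    by rewrite kn1 vn.
  by rewrite kn2 vn.
- move=> x y xy yn; have [yk|yk] := ltnP y k.
    have xyk : x < y < k by rewrite xy.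
    have [//|E] := pr cD x y xyk.
    have c02 : covered es [:: v 1; v k.-1].
      by apply/cA/covered_head; rewrite /= /joint /= !inE !eqxx ?orbT.
    case: E => [] [-> ->]; [exact: c02|exact: coveredC].
  have [yE|[yE|yE]] : y = k \/ (y = k.+1 \/ y = k.+2) by lia.
  + rewrite yE in xy *; apply: coveredC.
    have [j jk jE] := res x; rewrite modn_small // in jE; rewrite jE.
    have [->|j0] := eqVneq j 0.
      by apply/c1'; rewrite F1E; apply: covered_head; rewrite /= /joint /= !inE !eqxx ?orbT.
    have [->|j1] := eqVneq j k.-1.
      by apply/c4/covered_head; rewrite /= /joint /= !inE !eqxx ?orbT.
    have [|i ik <-] := @f1_onto j; first by lia.
    apply/c1/fan_mem; first by rewrite size_mkseq; lia.
    by apply/mapP; exists i => //; rewrite mem_iota.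
  + rewrite yE in xy *; apply: coveredC; have [xk|xk] := ltnP x k; last first.
      have -> : x = k by lia.
      by apply/c2'; rewrite F2E; apply: covered_head; rewrite /= /joint /= !inE !eqxx ?orbT.
    have [j jk jE] := res x; rewrite modn_small // in jE; rewrite jE.
    have [i ik <-] := @f2_onto j jk.
    apply/c2/fan_mem; first by rewrite size_mkseq; lia.
    by apply/mapP; exists i => //; rewrite mem_iota.
  rewrite yE in xy *; apply: coveredC; have [xk|xk] := ltnP x k.
    by have := sp x; rewrite (@modn_small x).
  have [->|xk'] := eqVneq x k.
    by apply/c4/covered_head; rewrite /= /joint /= !inE !eqxx ?orbT.
  have -> : x = k.+1 by lia.
  by apply/c3'/covered_head; rewrite /= /joint /= !inE !eqxx ?orbT.
rewrite szE bin2; have -> : n * n.-1 = ((3 * k + 2 + k * p).*2.-1).*2.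
  by rewrite nE kE (_ : (4 * p + 7 + 3).-1 = 4 * p + 9); lia.
by rewrite doubleK; lia.
Qed.
End FourPlusTen.

Lemma Hs_4p10 p n : 2 < p -> n = 4 * p + 10 -> ('C(n, 2) - 3)./2 <= Hs n 2.
Proof.
move=> p3 nE; pose k := n - 3; have kE : k = 4 * p + 7 by lia.
have k0 : 0 < k by lia.
have nE' : n = k + 3 by lia.
case k3 : (3 %| k).
  (* The steps by 3 form three cycles; [f1] and [f2] exchange a few steps by 1
     and by 3 so that each of them is still a single path. *)
  pose h := k %/ 3; have hE : k = 3 * h by have := divnK k3; rewrite /h; lia.
  pose f1 i := if i < 8 then nth 0 [:: 1; 4; 3; 2; 5; 8; 7; 6] i else i.+1.
  (* The path descends by 3 from k - 2 to 4, crosses to 5 and 6, descends through 3 and 0 to 9,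
     crosses to 8, ascends by 3 through k - 1 to 2 and ends at 1. Its steps 4-5, 5-6, 9-8, 2-1 are
     those that [f1] gives up for 1-4, 2-5, 5-8, 6-9. *)
  pose f2 i := if i < h.-1 then 3 * h - 2 - 3 * i else if i == h.-1 then 5
    else if i == h then 6 else if i == h.+1 then 3 else if i == h.+2 then 0
    else if i < 2 * h then 6 * h + 6 - 3 * i
    else if i < 3 * h - 2 then 8 + 3 * i - 6 * h
    else if i == 3 * h - 2 then 2 else 1.
  have h7 : 6 < h by lia.
  have f1v : [/\ f1 0 = 1, f1 1 = 4, f1 2 = 3, f1 3 = 2 &
      [/\ f1 4 = 5, f1 5 = 8, f1 6 = 7, f1 7 = 6 &
      forall i, 7 < i -> f1 i = i.+1]].
    by split=> //; split=> // i i7; rewrite /f1 ltnNge i7.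
  have [a0 a1 a2 a3 [a4 a5 a6 a7 a8]] := f1v.
  have i8 i : i < 8 -> i \in [:: 0; 1; 2; 3; 4; 5; 6; 7] by rewrite (mem_iota 0 8).
  have bA i : i < h.-1 -> f2 i = 3 * h - 2 - 3 * i by rewrite /f2 => ->.
  have b5 : f2 h.-1 = 5 by rewrite /f2; repeat case: ifP; lia.
  have b6 : f2 h = 6 by rewrite /f2; repeat case: ifP; lia.
  have b3 : f2 h.+1 = 3 by rewrite /f2; repeat case: ifP; lia.
  have b0 : f2 h.+2 = 0 by rewrite /f2; repeat case: ifP; lia.
  have bB i : h.+2 < i < 2 * h -> f2 i = 6 * h + 6 - 3 * i.
    by rewrite /f2; repeat case: ifP; lia.
  have bC i : 2 * h <= i < 3 * h - 2 -> f2 i = 8 + 3 * i - 6 * h.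
    by rewrite /f2; repeat case: ifP; lia.
  have b2 : f2 (3 * h - 2) = 2 by rewrite /f2; repeat case: ifP; lia.
  have bl : f2 (3 * h - 1) = 1 by rewrite /f2; repeat case: ifP; lia.
  apply: (@strip_4p10 p k n f1 f2) => //.
  - by rewrite a8; lia.
  - by rewrite /f2; case: ifP; lia.
  - by rewrite /f2; repeat case: ifP; lia.
  - move=> i ik; have [lt|ge] := ltnP i 8; last by rewrite a8; lia.
    by move: (i8 i lt); rewrite !inE; repeat (case/predU1P => [->|]); try (move/eqP=> ->); lia.
  - by move=> i ik; rewrite /f2; repeat case: ifP; lia.
  - move=> i ik; have [lt|ge] := ltnP i 8; last by rewrite !a8; lia.
    move: (i8 i lt); rewrite !inE; repeat (case/predU1P => [->|]);
      try (move/eqP=> ->); rewrite ?(a8 8); lia.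
  - by move=> i ik; rewrite /f2; repeat case: ifP; lia.
  - move=> j jk; have [lt|ge] := ltnP 8 j; first by exists j.-1; rewrite ?a8; lia.
    have : j \in iota 1 8 by rewrite mem_iota; lia.
    rewrite !inE; repeat (case/predU1P => [->|]); try (move/eqP=> ->);
      [exists 0|exists 3|exists 2|exists 1|exists 4|exists 7|exists 6|exists 5] => //; lia.
  - move=> j jk; have := divn_eq j 3; have := ltn_pmod j (isT : 0 < 3).
    move: (j %/ 3) (j %% 3) => u [|[|[|r]]] // _ jE.
    + have [?|[?|[?|?]]] : u = 0 \/ (u = 1 \/ (u = 2 \/ 2 < u)) by lia.
      * by exists h.+2; rewrite ?b0; lia.
      * by exists h.+1; rewrite ?b3; lia.
      * by exists h; rewrite ?b6; lia.
      by exists (2 * h + 2 - u); rewrite ?bB; lia.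
    + have [?|?] : u = 0 \/ 0 < u by lia.
        by exists (3 * h - 1); rewrite ?bl; lia.
      by exists (h - 1 - u); rewrite ?bA; lia.
    have [?|[?|?]] : u = 0 \/ (u = 1 \/ 1 < u) by lia.
    + by exists (3 * h - 2); rewrite ?b2; lia.
    + by exists h.-1; rewrite ?b5; lia.
    by exists (2 * h + u - 2); rewrite ?bC; lia.
  - move=> j jk; have [lt|ge] := ltnP 8 j.
      by left; exists j.-1; [lia|left; rewrite !a8; lia].
    have : j \in iota 1 8 by rewrite mem_iota; lia.
    rewrite !inE; repeat (case/predU1P => [->|]); try (move/eqP=> ->).
    + right; exists (3 * h - 2); [lia|right].
      have -> : (3 * h - 2).+1 = 3 * h - 1 by lia.
      by rewrite b2 bl.
    + by left; exists 2; [lia|right].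
    + by left; exists 1; [lia|right].
    + right; exists (h - 2); [lia|left].
      have -> : (h - 2).+1 = h.-1 by lia.
      by rewrite b5 bA; lia.
    + right; exists h.-1; [lia|left].
      by rewrite prednK ?b5 ?b6; lia.
    + by left; exists 6; [lia|right].
    + by left; exists 5; [lia|right].
    right; exists (2 * h - 1); [lia|right].
    have -> : (2 * h - 1).+1 = 2 * h by lia.
    by rewrite bB ?bC; lia.
  move=> j jk jk2.
  have jE3 : (j + 3 < k /\ (j + 3) %% k = j + 3) \/ (k <= j + 3 /\ (j + 3) %% k = j + 3 - k).
    have [lt|ge] := ltnP (j + 3) k; first by left; rewrite modn_small.
    right; split=> //; rewrite (@eq_mod_addM _ _ (j + 3 - k) 1); last by lia.
    by rewrite modn_small; lia.
  have := divn_eq j 3; have := ltn_pmod j (isT : 0 < 3).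
  move: (j %/ 3) (j %% 3) jE3 => u [|[|[|r]]] // jE3 _ jE.
  - have [?|[?|[?|[?|?]]]] : u = 0 \/ (u = 1 \/ (u = 2 \/ (2 < u < h.-1 \/ u = h.-1))) by lia.
    + by right; exists h.+1; [lia|right; rewrite b3 b0; lia].
    + by right; exists h; [lia|right; rewrite b6 b3; lia].
    + by left; exists 7; [lia|left; rewrite a7 a8; lia].
    + right; exists (2 * h + 1 - u); [lia|right].
      by rewrite !bB; lia.
    by right; exists h.+2; [lia|right; rewrite b0 bB; lia].
  - have [?|?] : u = 0 \/ 0 < u by lia.
      by left; exists 0; [lia|left; rewrite a0 a1; lia].
    by right; exists (h - 2 - u); [lia|right; rewrite !bA; lia].
  have [?|[?|[?|?]]] : u = 0 \/ (u = 1 \/ (1 < u < h.-1 \/ u = h.-1)) by lia.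
  - by left; exists 3; [lia|left; rewrite a3 a4; lia].
  - by left; exists 4; [lia|left; rewrite a4 a5; lia].
  - by right; exists (2 * h + u - 2); [lia|left; rewrite !bC; lia].
  right; exists (3 * h - 3); [lia|left].
  have -> : (3 * h - 3).+1 = 3 * h - 2 by lia.
  by rewrite b2 bC; lia.
(* Now 3 is invertible modulo [k], so the steps by -3 from k - 2 form one path through all indices,
   ending at 1. *)
pose f2 i := (k - 2 + (k - 3) * i) %% k.
have [u uE] : exists u, 3 * u = 1 %[mod k].
  have := divn_eq k 3; have := ltn_pmod k (isT : 0 < 3).
  have : k %% 3 != 0 by rewrite -/(dvdn 3 k) k3.
  move: (k %/ 3) (k %% 3) => h [|[|[|r]]] // _ _ hE.
    by exists (k - h); apply: (@eq_mod_addM _ _ _ 2); lia.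
  by exists h.+1; apply: (@eq_mod_addM _ _ _ 1); lia.
have onto j : j < k -> exists2 i, i < k & f2 i = j.
  (* Solving j = k - 2 - 3 i modulo [k] gives i = -u (j + 2). *)
  move=> jk; exists ((k.-1 * u * (j + 2)) %% k); first by rewrite ltn_mod.
  set X := k.-1 * u * (j + 2); rewrite /f2 -modnDmr modnMmr modnDmr -[RHS](modn_small jk).
  apply: (@eq_mod_cancelr _ _ _ (3 * X)).
  have X3 : 3 * X = k.-1 * (j + 2) %[mod k].
    have -> : 3 * X = 3 * u * (k.-1 * (j + 2)) by rewrite /X; lia.
    by rewrite -modnMml uE modnMml mul1n.
  have -> : k - 2 + (k - 3) * X + 3 * X = k - 2 + X * k.
    have -> : k = (k - 3) + 3 by lia.
    by rewrite addnK; lia.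
  rewrite (eq_mod_addM erefl) [j + _]addnC (eq_modDr j X3); apply/esym.
  apply: (@eq_mod_addM _ _ _ j.+1); have [K KE] : exists K, k = K.+2 by exists (k - 2); lia.
  by rewrite KE /= subn2 /=; lia.
have f2S i : f2 i = f2 i.+1 + 3 %[mod k].
  rewrite /f2 modn_mod modnDml; apply/esym.
  by apply: (@eq_mod_addM _ _ _ 1); rewrite mulnS; lia.
apply: (@strip_4p10 p k n succn f2) => //.
- by lia.
- by rewrite /f2 muln0 addn0 modn_small; lia.
- rewrite /f2 (@eq_mod_addM _ _ 1 (k - 3)); first by rewrite modn_small; lia.
  have [K KE] : exists K, k = K + 3 by exists (k - 3); lia.
  by rewrite KE addnK; lia.
- by move=> i; lia.
- by move=> i _; rewrite ltn_mod.
- by move=> i _; lia.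
- by move=> i _; apply: neq_mod => //; rewrite mulnS; lia.
- by move=> j jk; exists j.-1; lia.
- by move=> j jk; left; exists j.-1; [lia|left; lia].
move=> j jk jk2; right; have [[|i] ik iE] := onto j jk.
  by move: jk2; rewrite -iE /f2 muln0 addn0 modn_small ?eqxx; lia.
exists i => //; right; split=> //.
by rewrite -iE -f2S modn_mod.
Qed.

(** * Small n *)

(* These strips come from a computer search. *)
Definition small_strip (n : nat) : seq (nat * nat) :=
  match n with
  | 3 => [:: (0,1); (0,2)]
  | 4 => [:: (0,1); (1,2); (1,3)]
  | 5 => [:: (0,1); (0,2); (0,4); (4,3); (4,1)]
  | 6 => [:: (0,1); (0,2); (0,4); (0,5); (5,3); (3,1); (3,4)]
  | 7 => [:: (0,1); (0,2); (0,4); (4,6); (4,3); (4,1); (1,5); (5,6); (5,2);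
        (5,3); (5,0)]
  | 8 => [:: (0,1); (0,2); (2,4); (4,7); (7,3); (3,5); (5,1); (1,4); (1,6);
        (6,7); (6,0); (6,3); (6,2); (6,5)]
  | 9 => [:: (0,1); (0,2); (2,4); (2,3); (3,5); (5,6); (5,7); (7,1); (7,3);
        (3,0); (0,8); (8,5); (8,4); (8,7); (8,2); (8,6); (6,1); (6,4)]
  | 10 => [:: (0,1); (0,2); (2,6); (2,3); (2,8); (2,5); (2,7); (2,9); (9,4);
        (4,1); (1,3); (3,5); (3,9); (3,0); (0,7); (0,8); (0,4); (4,5);
        (4,6); (6,7); (6,1); (6,8); (6,9)]
  | 11 => [:: (0,1); (1,2); (1,4); (4,5); (4,10); (4,8); (4,9); (4,3); (4,7);
        (4,6); (6,0); (6,9); (9,2); (9,5); (9,7); (9,1); (1,10); (1,6);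
        (1,8); (8,3); (3,2); (2,10); (10,7); (7,0); (0,8); (0,5); (5,3);
        (5,6)]
  | 12 => [:: (0,1); (1,2); (2,6); (2,4); (2,10); (2,9); (2,5); (2,11); (2,3);
        (2,7); (7,8); (7,0); (7,9); (9,6); (6,11); (11,8); (8,1); (8,4);
        (8,5); (8,10); (8,3); (3,9); (3,4); (4,0); (4,11); (11,7); (7,10);
        (7,1); (1,5); (5,3); (5,6); (6,0); (6,10)]
  | 14 => [:: (0,1); (0,2); (0,12); (0,11); (11,5); (5,10); (5,8); (5,9); (9,4);
        (9,7); (7,3); (3,13); (3,6); (6,1); (6,10); (6,12); (12,4); (4,8);
        (8,2); (8,13); (8,11); (8,7); (7,1); (1,12); (1,9); (9,11); (11,6);
        (11,2); (11,3); (3,4); (3,10); (3,0); (0,8); (0,6); (6,7); (7,5);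
        (7,2); (2,10); (10,9); (9,13); (13,0); (13,4); (13,1); (13,5);
        (5,12); (5,3)]
  | 15 => [:: (0,1); (1,2); (13,2); (13,3); (13,4); (13,5); (13,6); (13,7);
        (13,8); (13,9); (13,10); (13,11); (13,12); (13,0); (14,0); (14,10);
        (14,7); (14,4); (14,1); (14,11); (14,8); (14,5); (14,2); (14,12);
        (14,9); (14,6); (6,3); (6,0); (0,11); (0,4); (4,8); (4,12); (12,10);
        (12,5); (5,7); (7,1); (7,9); (9,0); (9,5); (5,3); (3,11); (11,7);
        (11,2); (2,9); (2,4); (2,6); (2,8); (8,10); (8,3); (3,1); (1,12);
        (1,6); (1,10)]
  | 18 => [:: (0,1); (1,2); (16,2); (16,3); (16,4); (16,5); (16,6); (16,7);
        (16,8); (16,9); (16,10); (16,11); (16,12); (16,13); (16,14);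
        (16,15); (16,0); (17,0); (17,11); (17,6); (17,1); (17,12); (17,7);
        (17,2); (17,13); (17,8); (17,3); (17,14); (17,9); (17,4); (17,15);
        (17,10); (10,5); (10,0); (0,14); (14,7); (14,4); (14,1); (14,11);
        (14,8); (14,12); (14,5); (14,2); (2,6); (6,15); (6,13); (13,9);
        (13,3); (3,5); (5,11); (5,15); (15,8); (15,1); (15,9); (9,12);
        (12,0); (12,3); (12,6); (12,4); (12,10); (10,2); (10,8); (8,6);
        (8,0); (0,4); (4,13); (4,11); (11,2); (11,9); (9,7); (7,5); (7,1);
        (1,13); (1,10); (10,3); (3,7); (3,15)]
  | _ => [::]
  end.

Definition coveredb es x y :=
  has (fun ef : (nat * nat) * (nat * nat) => joint ef.1 ef.2 x && joint ef.1 ef.2 y)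
    (zip es (behead es)).

Lemma coveredbP es x y : coveredb es x y -> covered es [:: x; y].
Proof.
elim: es => // e [|f es] IH //= /orP[/andP[jx jy]|/IH/covered_cons//].
by apply: covered_head; rewrite /= jx jy.
Qed.

Definition missed n es :=
  [seq xy <- [seq (x, y) | y <- iota 0 n, x <- iota 0 y] | ~~ coveredb es xy.1 xy.2].

Lemma small_strip_Hs n (es := small_strip n) :
  [&& sorted touch es, all (fun e => (e.1 < n) && (e.2 < n)) es, 1 < size es &
      (size es).*2 + size (missed n es) <= 'C(n, 2).+1] ->
  (size es).-2 <= Hs n 2.
Proof.
move=> /and4P[h1 h2 h3 h4]; apply: (@strip_Hs n es (missed n es)) => // x y xy yn.
case c : (coveredb es x y); [left; exact: coveredbP|right].
rewrite mem_filter /= c /=; apply/allpairsPdep; exists y, x.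
by rewrite !mem_iota /= !add0n.
Qed.

(** These are the n >= 3 other than 6 that none of the four families reaches with p >= 3. *)
Lemma Hs_small n : n \in [:: 3; 4; 5; 7; 8; 9; 10; 11; 12; 14; 15; 18] ->
  ('C(n, 2) - 3)./2 <= Hs n 2.
Proof.
have /allP sz : all (fun n => ('C(n, 2) - 3)./2 == (size (small_strip n)).-2)
  [:: 3; 4; 5; 7; 8; 9; 10; 11; 12; 14; 15; 18] by vm_compute.
have /allP ok : all (fun n => let es := small_strip n in
    [&& sorted touch es, all (fun e => (e.1 < n) && (e.2 < n)) es, 1 < size es &
      (size es).*2 + size (missed n es) <= 'C(n, 2).+1])
  [:: 3; 4; 5; 7; 8; 9; 10; 11; 12; 14; 15; 18] by vm_compute.
by move=> nin; rewrite (eqP (sz n nin)); apply/small_strip_Hs/ok.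
Qed.

Lemma Hs_six_ge : 5 <= Hs 6 2.
Proof. by apply: (@small_strip_Hs 6); vm_compute. Qed.

(** * The exceptional case of six vertices *)

Section Runs.
Variable T : finType.
Implicit Types (t : {set T}) (ts : seq {set T}).

Definition star v ts := [set B in shadow ts | v \in B].

(** Each maximal block of [true] is counted at its last entry. *)
Fixpoint runs (b : seq bool) : nat :=
  if b is x :: b' then (x && ~~ head false b') + runs b' else 0.

Lemma star_duos v t : #|t| = 3 -> #|[set B in duos t | v \in B]| = (v \in t).*2.
Proof.
move=> t3; case vt : (v \in t); last first.
  apply: eq_card0 => B; rewrite !inE; apply/negP=> /andP[/andP[/subsetP s _] /s].
  by rewrite vt.
have c : #|duos t :\: [set B in duos t | v \in B]| = 1.
  have -> : duos t :\: [set B in duos t | v \in B] = duos (t :\ v).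
    apply/setP=> B; rewrite !inE subsetD1.
    by case: (B \subset t); case: (v \in B); case: (_ == 2).
  by have := cardsD1 v t; rewrite vt t3 card_duos add1n => -[<-].
have := cardsID [set B in duos t | v \in B] (duos t).
rewrite c card_duos t3 (_ : 'C(3, 2) = 3) // (setIidPr _); first by lia.
by apply/subsetP=> B; rewrite inE => /andP[].
Qed.

(* A run of [l] consecutive triangles through [v] covers [l + 1] edges at [v]. *)
Lemma card_star v ts : induced_strip ts ->
  #|star v ts| = count id [seq v \in t | t <- ts] + runs [seq v \in t | t <- ts].
Proof.
elim: ts => [|t r IH].
  by move=> _; apply: eq_card0 => B; rewrite !inE /shadow big_nil inE.
move=> str; have /and3P[/eqP t3 tr sr] := str.
have st := star_duos v t3.
have -> : star v (t :: r) = [set B in duos t | v \in B] :|: star v r.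
  by apply/setP=> B; rewrite /star shadow_cons !inE andb_orl.
rewrite cardsU st (IH sr) {IH}; case: r str tr sr => [|x r] str tr sr.
  have -> : [set B in duos t | v \in B] :&: star v [::] = set0.
    by apply/setP=> B; rewrite !inE /shadow big_nil inE andbF.
  by rewrite cards0 /=; case: (v \in t).
have /andP[/eqP tx tfar] := tr.
have -> : [set B in duos t | v \in B] :&: star v (x :: r) =
    if (v \in t) && (v \in x) then [set t :&: x] else set0.
  have E B : (B \in duos t) && (B \in shadow (x :: r)) = (B == t :&: x).
    apply/andP/eqP => [[Bt Bs]|->]; last first.
      by rewrite shadow_cons !inE subsetIl subsetIr tx eqxx.
    apply/eqP; rewrite eqEcard tx; move: (Bt); rewrite inE => /andP[Bt1 /eqP->].
    rewrite leqnn andbT subsetI Bt1.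
    move: Bs; rewrite shadow_cons inE => /orP[]; first by rewrite inE => /andP[].
    move=> /mem_shadow[y yr By]; have /duos_small d0 := allP tfar y yr.
    by have := in_set0 B; rewrite -d0 duosI in_setI Bt By.
  apply/setP=> B; rewrite in_setI [in X in X && _]inE [in X in _ && X]inE.
  rewrite andbACA E andbb; case: eqP => [->|n] /=.
    by rewrite inE; case: ifP; rewrite ?set11 ?inE.
  by case: ifP; rewrite !inE //; move/eqP: n => /negPf->.
rewrite /=; case: (v \in t); case: (v \in x) => /=; rewrite ?cards1 ?cards0 /=; lia.
Qed.

Lemma card_star_le v ts : #|star v ts| <= #|T|.-1.
Proof.
have -> : #|T|.-1 = #|~: [set v]| by have := cardsC1 v.
apply: leq_trans (leq_imset_card (fun w => [set v; w]) _); apply: subset_leq_card.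
apply/subsetP=> B; rewrite inE => /andP[/mem_shadow[t _]].
rewrite inE => /andP[_ /cards2P[a [b [ab ->]]]].
rewrite !inE => /orP[]/eqP->; apply/imsetP.
  by exists b; rewrite // !inE eq_sym.
by exists a; [rewrite !inE|exact: setUC].
Qed.

Lemma sum_mem t : \sum_(v : T) (v \in t) = #|t|.
Proof. by rewrite -sum1_card [RHS]big_mkcond /=; apply: eq_bigr => v _; case: (v \in t). Qed.

Lemma sum_mem_diff (t x : {set T}) : \sum_(v : T) ((v \in t) && (v \notin x)) = #|t :\: x|.
Proof. by rewrite -sum_mem; apply: eq_bigr => v _; rewrite inE andbC. Qed.

(** If [v] lay on neither neighbour, both shared edges would be [x :\ v], and [t] and [y] would have
    it in common. *)
Lemma no_isolated (t x y : {set T}) v : #|x| = 3 -> #|t :&: x| = 2 -> #|x :&: y| = 2 ->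
  #|t :&: y| <= 1 -> v \in x -> (v \in t) || (v \in y).
Proof.
move=> x3 tx xy ty vx; apply/negPn/negP; rewrite negb_or => /andP[vt vy].
have xv : #|x :\ v| = 2 by have := cardsD1 v x; rewrite vx x3 add1n => -[].
have E1 : t :&: x = x :\ v.
  by apply/eqP; rewrite eqEcard xv tx leqnn andbT subsetD1 subsetIr inE (negPf vt).
have E2 : x :&: y = x :\ v.
  by apply/eqP; rewrite eqEcard xv xy leqnn andbT subsetD1 subsetIl inE (negPf vy) andbF.
have : x :\ v \subset t :&: y by rewrite subsetI -{1}E1 -E2 subsetIl subsetIr.
by move/subset_leq_card; rewrite xv => /leq_trans/(_ ty).
Qed.
End Runs.

Lemma six_vertices (ts : seq {set 'I_6}) : induced_strip ts -> size ts <= 6.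
Proof.
case: ts => [|t0 [|t1 [|t2 [|t3 [|t4 [|t5 [|t6 [|t7 ts]]]]]]]] // str; last first.
  (* Eight triangles would need 17 edges, and there are 15. *)
  by have := size_induced_strip str isT; rewrite (_ : 'C(6, 2) = 15) //= !doubleS; lia.
have st v := card_star v str; have le v := card_star_le v [:: t0; t1; t2; t3; t4; t5; t6].
have := str; rewrite /= => /and3P[/eqP c0 /andP[/eqP d0 /andP[f0 _]]].
move=> /and3P[/eqP c1 /andP[/eqP d1 /andP[f1 _]]].
move=> /and3P[/eqP c2 /andP[/eqP d2 /andP[f2 _]]].
move=> /and3P[/eqP c3 /andP[/eqP d3 /andP[f3 _]]].
move=> /and3P[/eqP c4 /andP[/eqP d4 /andP[f4 _]]].
move=> /and3P[/eqP c5 /andP[/eqP d5 _]]; rewrite !andbT => /eqP c6.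
(* Two runs of length at least two would already use six edges at [v]. The left side counts the runs
   not ending at [t0]; among these only [t6] alone can have length one. *)
have key v : ((v \in t1) && (v \notin t2)) + (((v \in t2) && (v \notin t3)) +
    (((v \in t3) && (v \notin t4)) + (((v \in t4) && (v \notin t5)) +
    (((v \in t5) && (v \notin t6)) + (v \in t6))))) <= 1 + ((v \in t6) && (v \notin t5)).
  have := le v; rewrite st card_ord /=.
  have := no_isolated (v := v) c1 d0 d1 f0; have := no_isolated (v := v) c2 d1 d2 f1.
  have := no_isolated (v := v) c3 d2 d3 f2; have := no_isolated (v := v) c4 d3 d4 f3.
  have := no_isolated (v := v) c5 d4 d5 f4.
  do 7!case: (v \in _) => //=; intuition.
(* Summed over the six vertices, the inequality reads 5 + 3 <= 6 + 1, which is absurd. *)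
have := @leq_sum _ (index_enum _) predT _ _ (fun v _ => key v).
rewrite !big_split /= sum1_card card_ord.
rewrite !sum_mem_diff sum_mem c6.
have cD (A B : {set 'I_6}) : #|A| = 3 -> #|A :&: B| = 2 -> #|A :\: B| = 1.
  by move=> a b; rewrite cardsD a b.
rewrite !cD // setIC //.
Qed.

Lemma Hs_six : Hs 6 2 = 5.
Proof.
apply/eqP; rewrite eqn_leq Hs_six_ge andbT.
exact/Hs_le/six_vertices.
Qed.

(** * The value for all n and the floor formula *)

Lemma Hs_eq n : 2 < n -> n != 6 -> Hs n 2 = ('C(n, 2) - 3)./2.
Proof.
move=> n3 n6; apply/eqP; rewrite eqn_leq; apply/andP; split.
  apply: Hs_le => ts its; case: ts its => // t ts its.
  by have := size_induced_strip its isT; move: (size _) 'C(n, 2) => a b; lia.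
case sm : (n \in [:: 3; 4; 5; 7; 8; 9; 10; 11; 12; 14; 15; 18]); first exact: Hs_small.
move: sm; rewrite !inE => sm.
have := divn_eq n 4; have := ltn_pmod n (isT : 0 < 4).
move: (n %/ 4) (n %% 4) => p [|[|[|[|r]]]] // _ nE.
- by apply: (@Hs_4p4 (p - 1)); lia.
- by apply: (@Hs_4p1 p n (p + 1)); lia.
- by apply: (@Hs_4p10 (p - 2)); lia.
by apply: (@Hs_4p7 (p - 1)); lia.
Qed.

Import GRing.Theory Num.Theory.
Local Open Scope ring_scope.

(** With C = 3 + 2 m + o and [o] at most 1, the rational number is m + o / 2. *)
Lemma floor_half (C : nat) : (2 < C)%N ->
  Num.floor (1 / 2 * C%:R - 3 / 2 : rat) = ((C - 3)./2)%:Z.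
Proof.
move=> C3; apply: floor_def.
have CE : C = (3 + (C - 3)./2 * 2 + odd (C - 3))%N by have := odd_double_half (C - 3); lia.
move: CE; set m := (C - 3)./2; move: (odd _) => o ->.
rewrite !natrD natrM intrD -!pmulrn.
have : (0 <= o%:R :> rat) && (o%:R <= 1 :> rat) by case: o.
move: (o%:R : rat) (m%:R : rat) => y z; lra.
Qed.

Theorem theorem1p1 (n : nat) (hn : (3 <= n)%N) :
  (n <> 6%N ->
     (Hs n 2)%:Z = Num.floor (1 / 2 * 'C(n, 2)%:R - 3 / 2 : rat)) /\
  (n = 6%N ->
     Hs n 2 = 5%N /\
     5%:Z = Num.floor (1 / 2 * 'C(6, 2)%:R - 3 / 2 : rat) - 1).
Proof.
split=> [/eqP n6|->].
  by rewrite floor_half ?Hs_eq // (leq_trans _ (leq_bin2l 2 hn)).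
by rewrite Hs_six floor_half.
Qed.
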